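(* For all integers $n\geq 0$, $$S(256n+171) \equiv S(64n+43) \pmod{16}.$$
   Context: For $|q|<1$ (or as formal power series in $q$), let $(a;q)_\infty:=\prod_{k\geq 0}(1-aq^k)$. The function $S(n)$ (the number of overpartitions of $n$ of Schur-type, in the sense of Broudy and Lovejoy) is defined by the generating function $$\sum_{n=0}^{\infty} S(n)q^n = \frac{1}{(q;q^6)_\infty(q^5;q^6)_\infty(q^6;q^6)_\infty}.$$ *)

(* Defs.v *)
From mathcomp Require Import all_boot all_order all_algebra.

Set Implicit Arguments.
Unset Strict Implicit.
Unset Printing Implicit Defensive.

Import Order.TTheory GRing.Theory Num.Theory.
Local Open Scope ring_scope.

(* f : fps R stands for the formal power series \sum_(n >= 0) f n * q ^ n. *)
Definition fps (R : Type) : Type := nat -> R.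

Section FormalPowerSeries.
Variable R : comUnitRingType.

Definition fps_one : fps R := fun n => (n == 0%N)%:R.

Definition fps_mul (f g : fps R) : fps R :=
  fun n => \sum_(i < n.+1) f i * g (n - i)%N.

(* The coefficients g n, ..., g 0 (in that order) of g = 1 / f, from
   f 0 * g n.+1 = - \sum_(i <= n) f i.+1 * g (n - i). *)
Fixpoint fps_inv_rev (f : fps R) (n : nat) : seq R :=
  if n is m.+1 then
    let s := fps_inv_rev f m in
    (- ((f 0%N)^-1 * \sum_(i < m.+1) f i.+1 * s`_i)) :: s
  else [:: (f 0%N)^-1].

Definition fps_inv (f : fps R) : fps R := fun n => head 0 (fps_inv_rev f n).

Definition qpoch_part (a m N : nat) : {poly R} :=
  \prod_(k < N) (1 - 'X^(a + m * k)).

(* (q^a; q^m)_oo for m > 0: the factors with k > n do not contribute to the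
   coefficient of q^n, see qpoch_stable. *)
Definition qpoch (a m : nat) : fps R := fun n => (qpoch_part a m n.+1)`_n.

Lemma qpoch_stable (a m n N : nat) :
  (0 < m)%N -> (n < N)%N -> (qpoch_part a m N)`_n = qpoch a m n.
Proof.
move=> m_gt0; elim: N => // N IHN; rewrite ltnS leq_eqVlt => /predU1P[->//|ltnN].
rewrite -IHN // /qpoch_part big_ord_recr /= mulrBr mulr1 coefB coefMXn.
suff -> : (n < a + m * N)%N by rewrite subr0.
by apply: leq_trans ltnN (leq_trans (leq_pmull _ m_gt0) (leq_addl _ _)).
Qed.

Lemma qpoch0 (a m : nat) : (0 < a)%N -> qpoch a m 0 = 1.
Proof.
move=> a_gt0; rewrite /qpoch /qpoch_part big_ord1 muln0 addn0 coefB coefXn.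
by rewrite coef1 /= ltn_eqF // subr0.
Qed.

Lemma fps_mulV (f : fps R) :
  f 0%N \is a GRing.unit -> fps_mul f (fps_inv f) =1 fps_one.
Proof.
move=> uf; have nthE n i : (i <= n)%N -> (fps_inv_rev f n)`_i = fps_inv f (n - i)%N.
  elim: n i => [|n IHn] [|i] //= lein; rewrite IHn ?subSS //.
case=> [|n]; first by rewrite /fps_mul big_ord1 /fps_inv /= mulrV.
rewrite /fps_mul big_ord_recl /= subn0 {1}/fps_inv /= mulrN mulVKr //.
rewrite -[RHS](addNr (\sum_(i < n.+1) f i.+1 * (fps_inv_rev f n)`_i)).
congr (_ + _); apply: eq_bigr => i _.
by rewrite nthE -1?ltnS // /bump /= add1n subSS.
Qed.

End FormalPowerSeries.

(* S(n), the coefficient of q^n in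
   1 / ((q; q^6)_oo (q^5; q^6)_oo (q^6; q^6)_oo). *)
Definition schurS (n : nat) : int :=
  fps_inv (fps_mul (fps_mul (qpoch int 1 6) (qpoch int 5 6)) (qpoch int 6 6)) n.

Lemma schurS_gf :
  fps_mul (fps_mul (fps_mul (qpoch int 1 6) (qpoch int 5 6)) (qpoch int 6 6)) schurS
  =1 fps_one int.
Proof. by apply: fps_mulV; rewrite /fps_mul !big_ord1 !qpoch0 // !mulr1 unitr1. Qed.

(* Main.v *)
From HB Require Import structures.
Require Import Defs.
From mathcomp Require Import all_boot all_order all_algebra.
From mathcomp Require Import boolp.
From mathcomp Require Import zify ring.

(**
By the Jacobi triple product the generating function of S is 1 / T with
T(q) = \sum_(j in Z) (-1)^j q^(3j^2 - 2j).  Put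
  F = \sum q^(k(3k-1)/2),  G = \sum q^(3k^2+2k),  phi = \sum q^(k^2),  psi = \sum q^(2k^2-k)
(sums over Z), A = F(q^2), C = phi(q^3), H = psi(q^6); then T = A(q^4) - q G(q^4) and
G = A(q^4) + q G(q^4).  The function t = q G H / (A C) is a Hauptmodul for Gamma_0(12).  With
s = t(q^4) and x = A(q^4) / (q G(q^4)) one has
  x^4 = (1 + s) / (s (1 + 4 s)),   t (1 + 2 x s)^2 = s (1 - x + x^2 + (1 + 4 s) x^3),
so that Z[[q]] is graded over Z[[q^4]] by powers of x, and extracting the coefficients of
q^(4n+2) from r(t) / (q G) amounts to taking the x^0-part of r(t) / (1 + x).  Modulo 16 every
r(t) is a polynomial: starting with \sum S(4n+3) q^(n+1) = (t + 4 t^2 + 4 t^3) / G, the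
successive numerators are 7 t + 14 t^2 + 8 t^3 and then the fixed point 15 t + 6 t^2 + 8 t^3.

All theta identities come from changes of variables in double sums over Z^2, except
  C H (A^4 - q G^4) = A G (G^2 C^2 - 4 q A^2 H^2),
for which the double sums only show that the difference D of the two sides satisfies
D(q) = q u(q) D(q^2) for some series u; hence D = 0.
*)

Set Implicit Arguments.
Unset Strict Implicit.
Unset Printing Implicit Defensive.

Import Order.TTheory GRing.Theory Num.Theory.
Local Open Scope ring_scope.

(** * The ring of formal power series *)

HB.instance Definition _ (R : Type) := gen_eqMixin (fps R).
HB.instance Definition _ (R : Type) := gen_choiceMixin (fps R).

Section FpsRing.
Variable R : comUnitRingType.
Implicit Types f g h : fps R.

Lemma fpsP f g : f =1 g -> f = g.
Proof. by move=> fg; apply/funext. Qed.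

Definition fps_add f g : fps R := fun n => f n + g n.
Definition fps_opp f : fps R := fun n => - f n.
Definition fps_zero : fps R := fun=> 0.

Fact fps_addA : associative fps_add.
Proof. by move=> f g h; apply/fpsP => n; apply: addrA. Qed.
Fact fps_addC : commutative fps_add.
Proof. by move=> f g; apply/fpsP => n; apply: addrC. Qed.
Fact fps_add0 : left_id fps_zero fps_add.
Proof. by move=> f; apply/fpsP => n; apply: add0r. Qed.
Fact fps_addN : left_inverse fps_zero fps_opp fps_add.
Proof. by move=> f; apply/fpsP => n; apply: addNr. Qed.

HB.instance Definition _ :=
  GRing.isZmodule.Build (fps R) fps_addA fps_addC fps_add0 fps_addN.

Definition fps_trunc f (n : nat) : {poly R} := \poly_(i < n.+1) f i.

Lemma coef_trunc f n i : (i <= n)%N -> (fps_trunc f n)`_i = f i.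
Proof. by move=> le_in; rewrite coef_poly ltnS le_in. Qed.

(** Only coefficients up to [n] enter the coefficient of q^n in a product, so polynomial
    representatives suffice; associativity and commutativity then come from [{poly R}]. *)
Lemma fps_mul_coef f g (p r : {poly R}) n :
    (forall i, (i <= n)%N -> p`_i = f i) ->
    (forall i, (i <= n)%N -> r`_i = g i) ->
  fps_mul f g n = (p * r)`_n.
Proof.
move=> pf rg; rewrite coefM; apply: eq_bigr => i _.
by rewrite pf ?rg ?leq_subr // -ltnS.
Qed.

Fact fps_mulA : associative (@fps_mul R).
Proof.
move=> f g h; apply/fpsP => n.
rewrite (@fps_mul_coef _ _ (fps_trunc f n) (fps_trunc g n * fps_trunc h n)).
- rewrite (@fps_mul_coef _ _ (fps_trunc f n * fps_trunc g n) (fps_trunc h n)).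
  + by rewrite mulrA.
  + move=> i le_in; rewrite (@fps_mul_coef _ _ (fps_trunc f n) (fps_trunc g n)) //;
    by move=> j le_ji; rewrite coef_trunc // (leq_trans le_ji).
  + by move=> i le_in; rewrite coef_trunc.
- by move=> i le_in; rewrite coef_trunc.
- move=> i le_in; rewrite (@fps_mul_coef _ _ (fps_trunc g n) (fps_trunc h n)) //;
  by move=> j le_ji; rewrite coef_trunc // (leq_trans le_ji).
Qed.

Fact fps_mulC : commutative (@fps_mul R).
Proof.
move=> f g; apply/fpsP => n.
rewrite (@fps_mul_coef _ _ (fps_trunc f n) (fps_trunc g n)) 1?mulrC;
  try by move=> i le_in; rewrite coef_trunc.
by symmetry; apply: fps_mul_coef => i le_in; rewrite coef_trunc.
Qed.

Fact fps_mul1 : left_id (fps_one R) (@fps_mul R).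
Proof.
move=> f; apply/fpsP => n; rewrite (@fps_mul_coef _ _ 1 (fps_trunc f n)).
- by rewrite mul1r coef_trunc.
- by move=> i _; rewrite coef1.
- by move=> i le_in; rewrite coef_trunc.
Qed.

Fact fps_mulDl : left_distributive (@fps_mul R) fps_add.
Proof.
move=> f g h; apply/fpsP => n; rewrite /fps_add /fps_mul -big_split /=.
by apply: eq_bigr => i _; rewrite mulrDl.
Qed.

Fact fps_1_neq0 : fps_one R != 0.
Proof. by apply/eqP => /(congr1 (fun f : fps R => f 0%N)) /eqP; rewrite oner_eq0. Qed.

HB.instance Definition _ := GRing.Zmodule_isComNzRing.Build (fps R)
  fps_mulA fps_mulC fps_mul1 fps_mulDl fps_1_neq0.

Lemma fps_coefD f g n : (f + g) n = f n + g n. Proof. by []. Qed.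
Lemma fps_coefN f n : (- f) n = - f n. Proof. by []. Qed.
Lemma fps_coef1 n : (1 : fps R) n = (n == 0%N)%:R. Proof. by []. Qed.
Lemma fps_coefMn f m n : (f *+ m) n = f n *+ m.
Proof. by elim: m => // m IHm; rewrite !mulrS fps_coefD IHm. Qed.
Lemma fps_coef0M f g : (f * g) 0%N = f 0%N * g 0%N.
Proof. by rewrite /GRing.mul /= /fps_mul big_ord1. Qed.
Lemma fps_coef0X f n : (f ^+ n) 0%N = f 0%N ^+ n.
Proof. by elim: n => // n IHn; rewrite !exprS fps_coef0M IHn. Qed.
Lemma fps_coefM f g n : (f * g) n = \sum_(i < n.+1) f i * g (n - i)%N.
Proof. by []. Qed.

Lemma fps_divr f : f 0%N = 1 -> f * fps_inv f = 1.
Proof. by move=> f0; apply/fpsP/fps_mulV; rewrite f0 unitr1. Qed.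

Lemma fps_mulI f g h : f 0%N = 1 -> f * g = f * h -> g = h.
Proof.
move=> /fps_divr fV fgh; rewrite -[g]mulr1 -[h]mulr1 -fV.
by rewrite !mulrA ![_ * f]mulrC fgh.
Qed.

Definition fps_q : fps R := fun n => (n == 1%N)%:R.

Lemma fps_coefqM f n : (fps_q * f) n = if n is m.+1 then f m else 0.
Proof.
rewrite -[LHS]/(fps_mul fps_q f n) (@fps_mul_coef _ _ 'X (fps_trunc f n)).
- by rewrite coefXM; case: n => //= n; rewrite coef_trunc.
- by move=> i _; rewrite coefX.
- by move=> i le_in; rewrite coef_trunc.
Qed.

Lemma fps_qI f g : fps_q * f = fps_q * g -> f = g.
Proof.
move=> /(congr1 (fun h : fps R => h _.+1)) fg.
by apply/fpsP => n; have := fg n; rewrite !fps_coefqM.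
Qed.

Lemma fps_qXI k f g : fps_q ^+ k * f = fps_q ^+ k * g -> f = g.
Proof.
by elim: k f g => [|k IHk] f g; rewrite ?mul1r // exprSr -!mulrA => /IHk/fps_qI.
Qed.

Lemma fps_coefqXM k f n : (fps_q ^+ k * f) n = if (k <= n)%N then f (n - k)%N else 0.
Proof.
elim: k n => [|k IHk] n; first by rewrite mul1r subn0.
by rewrite exprS -mulrA fps_coefqM; case: n => // n; rewrite IHk.
Qed.

(* [fps_dil k f] is the series f(q^k), for k > 0. *)
Definition fps_dil (k : nat) f : fps R := fun n => if (k %| n)%N then f (n %/ k)%N else 0.

End FpsRing.

(** * Substitution of q^k for q *)

Section Dilation.
Variables (R : comUnitRingType) (k : nat).
Hypothesis k_gt0 : (0 < k)%N.
Implicit Types f g : fps R.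

Lemma fps_dil_coef0 f : fps_dil k f 0%N = f 0%N.
Proof. by rewrite /fps_dil dvdn0 div0n. Qed.

Lemma fps_dilD f g : fps_dil k (f + g) = fps_dil k f + fps_dil k g.
Proof. by apply/fpsP => n; rewrite fps_coefD /fps_dil; case: ifP; rewrite ?addr0. Qed.

Lemma fps_dilN f : fps_dil k (- f) = - fps_dil k f.
Proof. by apply/fpsP => n; rewrite fps_coefN /fps_dil; case: ifP; rewrite ?oppr0. Qed.

Lemma fps_dil1 : fps_dil k 1 = 1 :> fps R.
Proof.
apply/fpsP => n; rewrite /fps_dil !fps_coef1; case: ifP => [/dvdnP[m ->]|].
  by rewrite mulnK // muln_eq0 (gtn_eqF k_gt0) orbF.
by case: n => [|n]; rewrite ?dvdn0.
Qed.

Lemma fps_dilM f g : fps_dil k (f * g) = fps_dil k f * fps_dil k g.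
Proof.
have truncE h n i : (i <= n)%N -> (fps_trunc h n \Po 'X^k)`_i = fps_dil k h i.
  move=> le_in; rewrite coef_comp_poly_Xn // /fps_dil; case: ifP => // _.
  by rewrite coef_trunc // (leq_trans (leq_div _ _)).
apply/fpsP => n.
rewrite -[RHS]/(fps_mul (fps_dil k f) (fps_dil k g) n).
rewrite [RHS](@fps_mul_coef _ _ _ (fps_trunc f n \Po 'X^k) (fps_trunc g n \Po 'X^k));
  try exact: truncE.
rewrite -comp_polyM coef_comp_poly_Xn // /fps_dil; case: ifP => // _.
by apply: fps_mul_coef => i le_in; rewrite coef_trunc // (leq_trans le_in) ?leq_div.
Qed.

Lemma fps_dilX f m : fps_dil k (f ^+ m) = fps_dil k f ^+ m.
Proof. by elim: m => [|m IHm]; rewrite ?fps_dil1 // !exprS fps_dilM IHm. Qed.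

Lemma fps_dilMn f m : fps_dil k (f *+ m) = fps_dil k f *+ m.
Proof.
by elim: m => [|m IHm]; rewrite ?mulrS ?fps_dilD ?IHm //;
   apply/fpsP => n; rewrite /fps_dil; case: ifP.
Qed.

Lemma fps_dilq : fps_dil k (fps_q R) = fps_q R ^+ k.
Proof.
apply/fpsP => n; rewrite -[RHS]/((fps_q R ^+ k) n) -[fps_q R ^+ k]mulr1 fps_coefqXM.
rewrite /fps_dil /fps_q fps_coef1; case: ifP => [/dvdnP[m ->]|k_ndvd].
  rewrite mulnK //; case: m => [|[|m]]; first by rewrite leqNgt k_gt0.
    by rewrite mul1n leqnn subnn.
  by rewrite leq_pmull // !mulSn addKn addn_eq0 (gtn_eqF k_gt0).
case: ifP => // le_kn; case: eqP => // /eqP; rewrite subn_eq0 => le_nk.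
by rewrite (@anti_leq n k) ?le_nk // dvdnn in k_ndvd.
Qed.

End Dilation.

Lemma fps_dil_dil (R : comUnitRingType) j k (f : fps R) : (0 < j)%N -> (0 < k)%N ->
  fps_dil j (fps_dil k f) = fps_dil (k * j) f.
Proof.
move=> j_gt0 k_gt0; apply/fpsP => n; rewrite /fps_dil.
case: (boolP (j %| n)%N) => [/dvdnP[m ->]|nj].
  by rewrite mulnK // dvdn_pmul2r // divnMr.
by case: ifP => // /(dvdn_trans (dvdn_mull _ (dvdnn j))); rewrite (negPf nj).
Qed.

(** * Series counting the values of an exponent function *)

Section Counting.
Variable R : comUnitRingType.
Implicit Types f g : fps R.

(* f is the generating series \sum_(i : I) q ^ (e i). *)
Definition counts (I : eqType) (e : I -> int) f :=
  (forall i, 0 <= e i) /\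
  exists s : nat -> seq I, forall n,
    [/\ uniq (s n), forall i, (i \in s n) = (e i == n%:Z) & f n = (size (s n))%:R].

(** Two enumerations of the same finite fibre have the same size. The theta identities below are
    proved by showing that both sides count one exponent function. *)
Lemma counts_inj (I : eqType) (e : I -> int) f g :
  counts e f -> counts e g -> f = g.
Proof.
move=> [_ [s sP]] [_ [r rP]]; apply/fpsP => n.
have [us ms ->] := sP n; have [ur mr ->] := rP n; congr _%:R.
by apply/perm_size/uniq_perm => // i; rewrite ms mr.
Qed.

Lemma counts_coef (I : eqType) (e : I -> int) f n (r : seq I) :
    counts e f -> uniq r -> (forall i, e i = n%:Z -> i \in r) ->
  f n = \sum_(i <- r) (e i == n%:Z)%:R.
Proof.
move=> [_ [s sP]] ur rP; have [us ms ->] := sP n.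
rewrite -natr_sum; congr _%:R.
have -> : (\sum_(i <- r) (e i == n%:Z) = count (fun i => e i == n%:Z) r)%N.
  by rewrite -sum1_count [RHS]big_mkcond; apply: eq_bigr => i _; case: eqP.
rewrite -size_filter; apply/perm_size/uniq_perm => //; first exact: filter_uniq.
by move=> i; rewrite mem_filter ms; case: eqP => //= /rP ->.
Qed.

Lemma counts_reindex (I J : eqType) (e : I -> int) (h : J -> I) f :
    injective h -> (forall i, exists j, i = h j) ->
  counts (e \o h) f -> counts e f.
Proof.
move=> h_inj h_surj [e_ge0 [s sP]]; split=> [i|].
  by have [j ->] := h_surj i; apply: e_ge0.
exists (fun n => map h (s n)) => n; have [us ms fn] := sP n.
split; [by rewrite map_inj_uniq | | by rewrite size_map] => i.
by have [j ->] := h_surj i; rewrite mem_map // ms.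
Qed.

Lemma counts_split (I J K : eqType) (e : I -> int) (h : J -> I) (k : K -> I) f g :
    injective h -> injective k -> (forall j l, h j <> k l) ->
    (forall i, (exists j, i = h j) \/ (exists l, i = k l)) ->
  counts (e \o h) f -> counts (e \o k) g -> counts e (f + g).
Proof.
move=> h_inj k_inj hk hk_surj [eh_ge0 [s sP]] [ek_ge0 [r rP]]; split=> [i|].
  by case: (hk_surj i) => -[j ->]; [apply: eh_ge0 | apply: ek_ge0].
exists (fun n => map h (s n) ++ map k (r n)) => n.
have [us ms fn] := sP n; have [ur mr gn] := rP n; split.
- rewrite cat_uniq !map_inj_uniq // us ur andbT.
  by apply/hasPn => _ /mapP[l _ ->]; apply/mapP => -[j _ /esym]; apply: hk.
- move=> i; rewrite mem_cat; case: (hk_surj i) => -[j ->].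
    rewrite mem_map // ms orbC; case: mapP => // -[l _ /hk[]].
  by rewrite [k j \in map k _]mem_map // mr; case: mapP => // -[l _ /esym/hk].
- by rewrite fps_coefD fn gn size_cat !size_map natrD.
Qed.

Lemma counts_mul (I J : eqType) (e : I -> int) (e' : J -> int) f g :
  counts e f -> counts e' g -> counts (fun p : I * J => e p.1 + e' p.2) (f * g).
Proof.
move=> [e_ge0 [s sP]] [e'_ge0 [r rP]]; split=> [p|]; first by rewrite addr_ge0.
(* The fibre over [n] is cut according to the value [a] of [e], as in the Cauchy product. *)
pose blk n a := [seq (i, j) | i <- s a, j <- r (n - a)%N].
have blkP n a i j : (i, j) \in blk n a -> e i = a%:Z /\ e' j = (n - a)%N.
  case: (sP a) (rP (n - a)%N) => [_ ms _] [_ mr _].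
  by case/allpairsP => p [+ + [-> ->]]; rewrite ms mr => /eqP-> /eqP->.
exists (fun n => [seq p | a <- iota 0 n.+1, p <- blk n a]) => n; split.
- apply: allpairs_uniq_dep => [|a _|]; first exact: iota_uniq.
    have [us _ _] := sP a; have [ur _ _] := rP (n - a)%N.
    by apply: allpairs_uniq => // -[i j] [i' j'].
  move=> u v /allpairsPdep[a [[i j] [_ /blkP[ei _] ->]]].
  move=> /allpairsPdep[b [[i' j'] [_ /blkP[ei' _] ->]]] /= [ii jj].
  by move: ei ei'; rewrite ii jj => -> [->].
- move=> [i j]; apply/allpairsPdep/eqP => [[a [p [an + ijp]]]|eij].
    by rewrite mem_iota in an; rewrite -{}ijp => /blkP[-> ->]; lia.
  have ge0i := e_ge0 i; have ge0j := e'_ge0 j; rewrite /= in eij.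
  exists `|e i|%N, (i, j); split=> //; first by rewrite mem_iota; lia.
  apply/allpairsP; exists (i, j); case: (sP `|e i|%N) (rP (n - `|e i|)%N) => [_ ms _] [_ mr _].
  by rewrite /= ms mr; split=> //; apply/eqP; lia.
- rewrite fps_coefM size_allpairs_dep sumnE big_map -[in RHS](subn0 n.+1) -/(index_iota _ _).
  rewrite big_mkord natr_sum; apply: eq_bigr => a _.
  by have [_ _ ->] := sP a; have [_ _ ->] := rP (n - a)%N; rewrite size_allpairs natrM.
Qed.

Lemma counts_dil (I : eqType) (e : I -> int) k f : (0 < k)%N ->
  counts e f -> counts (fun i => k%:Z * e i) (fps_dil k f).
Proof.
move=> k_gt0 [e_ge0 [s sP]]; split=> [i|]; first by rewrite mulr_ge0.
exists (fun n => if (k %| n)%N then s (n %/ k)%N else [::]) => n; rewrite /fps_dil.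
case: ifP => [/dvdnP[m ->]|k_ndvd].
  rewrite mulnK //; have [us ms fm] := sP m; split=> // i; rewrite ms mulnC PoszM.
  by rewrite (inj_eq (mulfI _)) // eqz_nat -lt0n.
split=> // i; rewrite in_nil; apply/esym/eqP => eki; have ge0i := e_ge0 i.
by case/negP: (negbT k_ndvd); apply/dvdnP; exists `|e i|%N; nia.
Qed.

Lemma counts_shift (I : eqType) (e : I -> int) k f :
  counts e f -> counts (fun i => k%:Z + e i) (fps_q R ^+ k * f).
Proof.
move=> [e_ge0 [s sP]]; split=> [i|]; first by rewrite addr_ge0.
exists (fun n => if (k <= n)%N then s (n - k)%N else [::]) => n.
rewrite fps_coefqXM; case: leqP => [le_kn|lt_nk].
  by have [us ms fm] := sP (n - k)%N; split=> // i; rewrite ms; apply/eqP/eqP; lia.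
by split=> // i; rewrite in_nil; apply/esym/eqP; have := e_ge0 i; lia.
Qed.

Lemma counts_ext (I : eqType) (e e' : I -> int) f : e =1 e' -> counts e f -> counts e' f.
Proof. by move=> /funext->. Qed.

Definition zball (n : nat) : seq int := [seq i%:Z - n%:Z | i <- iota 0 (2 * n).+1].

Lemma mem_zball n k : (k \in zball n) = (`|k| <= n)%N.
Proof.
apply/mapP/idP => [[i]|le_kn]; first by rewrite mem_iota => ? ->; lia.
by exists (absz (k + n%:Z)); rewrite ?mem_iota; lia.
Qed.

Lemma uniq_zball n : uniq (zball n).
Proof. by rewrite map_inj_uniq ?iota_uniq // => i j; lia. Qed.

(** Only [k] in [zball n] are tested; nothing is missed when [|k| <= e k], the condition of
    [counts_theta]. *)
Definition theta (e : int -> int) : fps R :=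
  fun n => (count (fun k => e k == n%:Z) (zball n))%:R.

Lemma counts_theta (e : int -> int) :
  (forall k, `|k| <= e k) -> counts e (theta e).
Proof.
move=> e_ge; split=> [k|]; first by apply: le_trans (e_ge k).
exists (fun n => [seq k <- zball n | e k == n%:Z]) => n; split.
- by rewrite filter_uniq ?uniq_zball.
- move=> k; rewrite mem_filter mem_zball; case: eqP => //= ek.
  by have := e_ge k; rewrite ek; lia.
- by rewrite size_filter.
Qed.

End Counting.

(** * Theta series *)

Definition pent_exp (k : int) : int := ((k * (3 * k - 1)) %/ 2)%Z.

Lemma pent_expE k : 2 * pent_exp k = k * (3 * k - 1).
Proof.
have [j] : exists j, k = 2 * j \/ k = 2 * j + 1 by exists (k %/ 2)%Z; lia.
rewrite /pent_exp; case=> ->.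
  rewrite (_ : 2 * j * _ = j * (6 * j - 1) * 2); last by ring.
  by rewrite mulzK //; ring.
rewrite (_ : (2 * j + 1) * _ = (2 * j + 1) * (3 * j + 1) * 2); last by ring.
by rewrite mulzK //; ring.
Qed.

Lemma counts_ext2 (R : comUnitRingType) (e e' : int * int -> int) (f : fps R) :
  (forall a b : int, e (a, b) = e' (a, b)) -> counts e f -> counts e' f.
Proof. by move=> ee'; apply: counts_ext => -[a b]. Qed.

Section ThetaIdentities.
Variable R : comUnitRingType.

Notation q := (fps_q R).
Notation dil := fps_dil.

(** [pent] and [oct] are the F and G of the header, with the generalized pentagonal and octagonal
    numbers as exponents; those of [psi] are the triangular numbers, each taken once. *)
Definition pent : fps R := theta R pent_exp.
Definition oct : fps R := theta R (fun k => 3 * k ^+ 2 + 2 * k).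
Definition phi : fps R := theta R (fun k => k ^+ 2).
Definition psi : fps R := theta R (fun k => 2 * k ^+ 2 - k).

Lemma counts_pent : counts pent_exp pent.
Proof. by apply: counts_theta => k; have := pent_expE k; nia. Qed.

Lemma counts_oct : counts (fun k => 3 * k ^+ 2 + 2 * k) oct.
Proof. by apply: counts_theta => k; rewrite expr2; nia. Qed.

Lemma counts_phi : counts (fun k => k ^+ 2) phi.
Proof. by apply: counts_theta => k; rewrite expr2; nia. Qed.

Lemma counts_psi : counts (fun k => 2 * k ^+ 2 - k) psi.
Proof. by apply: counts_theta => k; rewrite expr2; nia. Qed.

Lemma pent0 : pent 0%N = 1. Proof. by []. Qed.
Lemma oct0 : oct 0%N = 1. Proof. by []. Qed.
Lemma phi0 : phi 0%N = 1. Proof. by []. Qed.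
Lemma psi0 : psi 0%N = 1. Proof. by []. Qed.

Lemma oct_dissect : oct = dil 8 pent + q * dil 4 oct.
Proof.
apply: (counts_inj counts_oct).
apply: (@counts_split _ _ _ _ _ (fun k => - 2 * k) (fun k => - 2 * k - 1)).
- by move=> j k; lia.
- by move=> j k; lia.
- by move=> j k; lia.
- move=> i; have [] : exists k, i = - 2 * k \/ i = - 2 * k - 1.
    by exists ((- i) %/ 2)%Z; lia.
  by move=> k [->|->]; [left|right]; exists k.
- apply: counts_ext (counts_dil _ counts_pent) => // k /=.
  by have := pent_expE k; rewrite expr2; nia.
- rewrite -[q]expr1; apply: counts_ext (counts_shift 1 (counts_dil _ counts_oct)) => // k /=.
  by ring.
Qed.

Lemma phi_dissect : phi = dil 4 phi + 2 * (q * dil 8 psi).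
Proof.
rewrite mulr_natl mulr2n; apply: (counts_inj counts_phi).
(* Since 1 + 8(2k^2 - k) = (4k - 1)^2, each odd square arises from the two roots 4k - 1 and 1 - 4k,
   whence the factor 2. *)
have odd_part : counts (fun k => (2 * k + 1) ^+ 2) (q * dil 8 psi + q * dil 8 psi).
  apply: (@counts_split _ _ _ _ _ (fun k => 2 * k - 1) (fun k => - 2 * k)).
  - by move=> j k; lia.
  - by move=> j k; lia.
  - by move=> j k; lia.
  - move=> i; have [] : exists k, i = 2 * k - 1 \/ i = - 2 * k.
      by case: (boolP ((i %% 2)%Z == 0)); [exists (- (i %/ 2)%Z) | exists ((i + 1) %/ 2)%Z]; lia.
    by move=> k [->|->]; [left|right]; exists k.
  - rewrite -[q]expr1; apply: counts_ext (counts_shift 1 (counts_dil _ counts_psi)) => // k /=.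
    by ring.
  - rewrite -[q]expr1; apply: counts_ext (counts_shift 1 (counts_dil _ counts_psi)) => // k /=.
    by ring.
apply: (@counts_split _ _ _ _ _ (fun k => 2 * k) (fun k => 2 * k + 1)) odd_part.
- by move=> j k; lia.
- by move=> j k; lia.
- by move=> j k; lia.
- move=> i; have [] : exists k, i = 2 * k \/ i = 2 * k + 1 by exists (i %/ 2)%Z; lia.
  by move=> k [->|->]; [left|right]; exists k.
- by apply: counts_ext (counts_dil _ counts_phi) => // k /=; ring.
Qed.

Lemma pent_psi : pent * dil 3 psi = oct * dil 2 pent.
Proof.
apply: (counts_inj (counts_mul counts_pent (counts_dil _ counts_psi))) => //.
(* Completing squares turns the two exponents into u^2 + v^2 and 2(x^2 + y^2) with u = 6m - 1, v =
   12k - 3, x = 6a + 2, y = 6b - 1. The map is u = -(x + y), v = x - y or y - x, the sign of v being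
   fixed by its residue modulo 12. *)
pose h (p : int * int) := (- (p.1 + p.2),
  if ((p.1 + p.2) %% 2)%Z == 0 then ((p.2 - p.1) %/ 2)%Z
  else ((p.1 - p.2 + 1) %/ 2)%Z).
apply: (@counts_reindex _ _ _ _ h).
- move=> [a b] [c d]; rewrite /h /= => -[e1].
  by case: ifP; case: ifP => ? ? e2; congr (_, _); lia.
- move=> [m k]; rewrite /h.
  case: (boolP ((m %% 2)%Z == 0)) => m2.
    exists (((- m) %/ 2)%Z - k, ((- m) %/ 2)%Z + k) => /=.
    by case: ifP => ?; congr (_, _); lia.
  exists (((- m - 1) %/ 2)%Z + k, ((- m + 1) %/ 2)%Z - k) => /=.
  by case: ifP => ?; congr (_, _); lia.
- suff expE (a b : int) : 3 * a ^+ 2 + 2 * a + 2%:Z * pent_exp b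
      = pent_exp (h (a, b)).1 + 3%:Z * (2 * (h (a, b)).2 ^+ 2 - (h (a, b)).2).
    by apply: counts_ext (counts_mul counts_oct (counts_dil _ counts_pent))
        => // -[a b]; apply: expE.
  rewrite /h /=; have := pent_expE (- (a + b)); have := pent_expE b.
  move: (pent_exp _) (pent_exp _) => u v.
  have [n] : exists n : int, a + b = 2 * n \/ a + b = 2 * n + 1 by exists ((a + b) %/ 2)%Z; lia.
  case: ifP => ab2 [] abn; try lia.
    have -> : ((b - a) %/ 2)%Z = b - n by lia.
    by have -> : a = 2 * n - b; [lia | rewrite !expr2; lia].
  have -> : ((a - b + 1) %/ 2)%Z = n + 1 - b by lia.
  by have -> : a = 2 * n + 1 - b; [lia | rewrite !expr2; lia].
Qed.

Lemma psi_sqr : psi ^+ 2 = phi * dil 2 psi.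
Proof.
rewrite expr2; apply: (counts_inj (counts_mul counts_psi counts_psi)) => //.
(* Again a rotation: with u = 2c + 4d - 1 and v = 4d - 1 - 2c, the pair (4i - 1, 4j - 1) is (u, v)
   for even c and (-v, -u) for odd c, as the residues modulo 4 require. *)
pose h (p : int * int) :=
  if (p.1 %% 2)%Z == 0 then (((p.1 + 2 * p.2) %/ 2)%Z, ((2 * p.2 - p.1) %/ 2)%Z)
  else (((p.1 + 1 - 2 * p.2) %/ 2)%Z, ((1 - 2 * p.2 - p.1) %/ 2)%Z).
apply: (@counts_reindex _ _ _ _ h).
- move=> [a b] [c d]; rewrite /h /=.
  by case: ifP; case: ifP => ? ? [? ?]; congr (_, _); lia.
- move=> [a b]; rewrite /h.
  case: (boolP (((a - b) %% 2)%Z == 0)) => m2.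
    exists (a - b, ((a + b) %/ 2)%Z) => /=.
    by case: ifP => ?; congr (_, _); lia.
  exists (a - b, ((1 - a - b) %/ 2)%Z) => /=.
  by case: ifP => ?; congr (_, _); lia.
- apply: counts_ext (counts_mul counts_phi (counts_dil _ counts_psi)) => // -[c d] /=.
  rewrite /h /=.
  have [n] : exists n : int, c = 2 * n \/ c = 2 * n + 1 by exists (c %/ 2)%Z; lia.
  case: ifP => c2 [] cn /=; try lia; rewrite cn.
    have -> : ((2 * n + 2 * d) %/ 2)%Z = n + d by lia.
    have -> : ((2 * d - 2 * n) %/ 2)%Z = d - n by lia.
    by ring.
  have -> : ((2 * n + 1 + 1 - 2 * d) %/ 2)%Z = n + 1 - d by lia.
  have -> : ((1 - 2 * d - (2 * n + 1)) %/ 2)%Z = - d - n by lia.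
  by ring.
Qed.

(** Pairs (i, j) are split by the parity of i - j. The next two identities use the same kind of
    splitting. *)
Lemma pent_sqr :
  pent ^+ 2 = dil 2 pent * dil 3 phi + 2 * (q * (oct * dil 6 psi)).
Proof.
rewrite expr2 mulr_natl mulr2n; apply: (counts_inj (counts_mul counts_pent counts_pent)).
have psiE : counts (fun p : int * int => 1%:Z + ((3 * p.1 ^+ 2 + 2 * p.1)
    + 6%:Z * (2 * p.2 ^+ 2 - p.2)))
    (q * (oct * dil 6 psi)).
  rewrite -[q]expr1.
  by apply: counts_ext2 (counts_shift 1 (counts_mul counts_oct (counts_dil _ counts_psi))).
(* The exponent is 1 + (3a^2 + 2a) + 3b(b + 1), invariant under b -> -1 - b; both b = 2k - 1 and b =
   -2k give b(b + 1)/2 = 2k^2 - k, whence the factor 2. *)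
have odd_part : counts (fun p : int * int => pent_exp (p.1 + 1 + p.2) + pent_exp (p.1 - p.2))
    (q * (oct * dil 6 psi) + q * (oct * dil 6 psi)).
  apply: (@counts_split _ _ _ _ _ (fun p : int * int => (p.1, 2 * p.2 - 1))
            (fun p : int * int => (p.1, - 2 * p.2))).
  - by move=> [a b] [c d] /= [? ?]; congr (_, _); lia.
  - by move=> [a b] [c d] /= [? ?]; congr (_, _); lia.
  - by move=> [a b] [c d] /= [? ?]; lia.
  - move=> [i j]; have [k] : exists k, j = 2 * k - 1 \/ j = - 2 * k.
      by case: (boolP ((j %% 2)%Z == 0)); [exists (- (j %/ 2)%Z) | exists ((j + 1) %/ 2)%Z]; lia.
    by case=> ->; [left|right]; exists (i, k).
  - apply: counts_ext2 psiE => a b /=.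
    have := pent_expE (a + 1 + (2 * b - 1)); have := pent_expE (a - (2 * b - 1)).
    by move: (pent_exp _) (pent_exp _) => u v; rewrite !expr2; lia.
  - apply: counts_ext2 psiE => a b /=.
    have := pent_expE (a + 1 + (- 2 * b)); have := pent_expE (a - (- 2 * b)).
    by move: (pent_exp _) (pent_exp _) => u v; rewrite !expr2; lia.
apply: (@counts_split _ _ _ _ _ (fun p : int * int => (p.1 + p.2, p.1 - p.2))
          (fun p : int * int => (p.1 + 1 + p.2, p.1 - p.2))) odd_part.
- by move=> [a b] [c d] /= [? ?]; congr (_, _); lia.
- by move=> [a b] [c d] /= [? ?]; congr (_, _); lia.
- by move=> [a b] [c d] /= [? ?]; lia.
- move=> [i j]; have [k] : exists k, i - j = 2 * k \/ i - j = 2 * k + 1.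
    by exists ((i - j) %/ 2)%Z; lia.
  by case=> ijk; [left|right]; exists (j + k, k); congr (_, _); rewrite /=; lia.
- apply: counts_ext2 (counts_mul (counts_dil _ counts_pent) (counts_dil _ counts_phi)) => // a b /=.
  have := pent_expE (a + b); have := pent_expE (a - b); have := pent_expE a.
  by move: (pent_exp _) (pent_exp _) (pent_exp _) => u v w; rewrite !expr2; lia.
Qed.

Lemma oct_phi : oct * dil 3 phi = dil 4 pent ^+ 2 + q * dil 2 oct ^+ 2.
Proof.
rewrite !expr2; apply: (counts_inj (counts_mul counts_oct (counts_dil _ counts_phi))) => //.
apply: (@counts_split _ _ _ _ _ (fun p : int * int => (- p.1 - p.2, p.2 - p.1))
          (fun p : int * int => (- p.1 - p.2 - 1, p.2 - p.1))).
- by move=> [a b] [c d] /= [? ?]; congr (_, _); lia.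
- by move=> [a b] [c d] /= [? ?]; congr (_, _); lia.
- by move=> [a b] [c d] /= [? ?]; lia.
- move=> [i j]; have [k] : exists k, i + j = - 2 * k \/ i + j = - 2 * k - 1.
    by exists ((- i - j) %/ 2)%Z; lia.
  by case=> ijk; [left|right]; exists (k, j + k); congr (_, _); rewrite /=; lia.
- apply: counts_ext2 (counts_mul (counts_dil _ counts_pent)
    (counts_dil _ counts_pent)) => // a b /=.
  have := pent_expE a; have := pent_expE b.
  by move: (pent_exp _) (pent_exp _) => u v; rewrite !expr2; lia.
- rewrite -[q]expr1.
  apply: counts_ext2 (counts_shift 1 (counts_mul (counts_dil _ counts_oct)
      (counts_dil _ counts_oct))) => // a b /=.
  by ring.
Qed.

Lemma oct_sqr :
  oct ^+ 2 = dil 2 oct * dil 6 phi + 2 * (q * (dil 4 pent * dil 12 psi)).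
Proof.
rewrite expr2 mulr_natl mulr2n; apply: (counts_inj (counts_mul counts_oct counts_oct)).
have psiE : counts (fun p : int * int => 1%:Z + (4%:Z * pent_exp p.1
    + 12%:Z * (2 * p.2 ^+ 2 - p.2)))
    (q * (dil 4 pent * dil 12 psi)).
  rewrite -[q]expr1.
  by apply: counts_ext2 (counts_shift 1 (counts_mul (counts_dil _ counts_pent)
    (counts_dil _ counts_psi))).
have odd_part : counts (fun p : int * int => (3 * (p.1 + p.2) ^+ 2 + 2 * (p.1 + p.2))
       + (3 * (p.1 - 1 - p.2) ^+ 2 + 2 * (p.1 - 1 - p.2)))
    (q * (dil 4 pent * dil 12 psi) + q * (dil 4 pent * dil 12 psi)).
  apply: (@counts_split _ _ _ _ _ (fun p : int * int => (p.1, 2 * p.2 - 1))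
            (fun p : int * int => (p.1, - 2 * p.2))).
  - by move=> [a b] [c d] /= [? ?]; congr (_, _); lia.
  - by move=> [a b] [c d] /= [? ?]; congr (_, _); lia.
  - by move=> [a b] [c d] /= [? ?]; lia.
  - move=> [i j]; have [k] : exists k, j = 2 * k - 1 \/ j = - 2 * k.
      by case: (boolP ((j %% 2)%Z == 0)); [exists (- (j %/ 2)%Z) | exists ((j + 1) %/ 2)%Z]; lia.
    by case=> ->; [left|right]; exists (i, k).
  - by apply: counts_ext2 psiE => a b /=; have := pent_expE a; rewrite !expr2; lia.
  - by apply: counts_ext2 psiE => a b /=; have := pent_expE a; rewrite !expr2; lia.
apply: (@counts_split _ _ _ _ _ (fun p : int * int => (p.1 + p.2, p.1 - p.2))
          (fun p : int * int => (p.1 + p.2, p.1 - 1 - p.2))) odd_part.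
- by move=> [a b] [c d] /= [? ?]; congr (_, _); lia.
- by move=> [a b] [c d] /= [? ?]; congr (_, _); lia.
- by move=> [a b] [c d] /= [? ?]; lia.
- move=> [i j]; have [k] : exists k, i - j = 2 * k \/ i - j = 2 * k + 1.
    by exists ((i - j) %/ 2)%Z; lia.
  case=> ijk; [left; exists (j + k, k)|right; exists (j + k + 1, k)];
  by congr (_, _); rewrite /=; lia.
- apply: counts_ext2 (counts_mul (counts_dil _ counts_oct) (counts_dil _ counts_phi)) => // a b /=.
  by ring.
Qed.

End ThetaIdentities.

(** * The Jacobi triple product *)

Section QBinomial.
Variables (K : comNzRingType) (p : K).

(** Gaussian binomials in base [p], given by the Pascal rule so as to make sense in any commutative
    ring. *)
Fixpoint qbin (N k : nat) : K :=
  match N, k with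
  | _, 0%N => 1
  | 0%N, _.+1 => 0
  | N'.+1, k'.+1 => qbin N' k' + p ^+ k * qbin N' k
  end.

Lemma qbin0 N : qbin N 0 = 1. Proof. by case: N. Qed.

Lemma qbin_small N k : (N < k)%N -> qbin N k = 0.
Proof.
elim: N k => [|N IHN] [|k] //= ltNk; rewrite !IHN ?mulr0 ?addr0 //.
exact: ltnW.
Qed.

(** Splitting off the factor i = 0 turns [y] into [y * p] in the remaining product, hence an
    induction with [y] general. *)
Lemma qbinomial N (u y : K) :
  \prod_(i < N) (u + y * p ^+ i)
  = \sum_(k < N.+1) qbin N k * p ^+ 'C(k, 2) * y ^+ k * u ^+ (N - k).
Proof.
elim: N y => [|N IHN] y; first by rewrite big_ord0 big_ord1 /= !mulr1.
rewrite big_ord_recl mulr1.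
under eq_bigr => i _ do rewrite exprS mulrA.
rewrite IHN.
(* [a] and [b] collect the terms in which the split-off factor contributes [u] and [y];
   [b k + a k.+1] recombines by the Pascal rule. *)
pose a k := qbin N k * p ^+ ('C(k, 2) + k) * y ^+ k * u ^+ (N.+1 - k).
pose b k := qbin N k * p ^+ ('C(k, 2) + k) * y ^+ k.+1 * u ^+ (N - k).
transitivity (\sum_(k < N.+1) a k + \sum_(k < N.+1) b k).
  rewrite mulrDl !mulr_sumr; congr (_ + _); apply: eq_bigr => k _.
    by rewrite /a subSn -1?ltnS // exprMn exprD exprS; ring.
  by rewrite /b exprMn exprD exprS; ring.
transitivity (a 0%N + \sum_(k < N.+1) (b k + a k.+1)); last first.
  rewrite [RHS]big_ord_recl; congr (_ + _); first by rewrite /a qbin0.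
  apply: eq_bigr => k _; rewrite lift0 /a /b [qbin N.+1 _]/= subSS binS bin1 !exprD !exprS.
  by ring.
rewrite big_split /= addrCA [RHS]addrC; congr (_ + _).
transitivity (\sum_(k < N.+2) a k); last by rewrite big_ord_recl.
have aN : a N.+1 = 0 by rewrite /a qbin_small // !mul0r.
by rewrite [RHS]big_ord_recr /= aN addr0.
Qed.

Definition qfact (n : nat) : K := \prod_(i < n) (1 - p ^+ i.+1).

Lemma qbinn n : qbin n n = 1.
Proof. by elim: n => //= n ->; rewrite qbin_small // mulr0 addr0. Qed.

Lemma qfactS n : qfact n.+1 = qfact n * (1 - p ^+ n.+1).
Proof. by rewrite /qfact big_ord_recr. Qed.

Lemma qbin_fact k l : qbin (k + l) k * qfact k * qfact l = qfact (k + l).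
Proof.
have qfact0 : qfact 0 = 1 by rewrite /qfact big_ord0.
move: {2}(k + l)%N (leqnn (k + l)%N) => N; elim: N k l => [|N IHN] [|k] [|l];
  rewrite ?addn0 ?qbin0 ?qbinn ?qfact0 ?mulr1 ?mul1r //.
rewrite addSn ltnS addnS => le_N /=.
have /= := IHN k l.+1; rewrite addnS => /(_ le_N) e1.
have /= := IHN k.+1 l; rewrite addSn => /(_ le_N) e2.
rewrite [qfact (k + l).+2]qfactS.
(* The Pascal rule, matched with 1 - p^(k+l+2) = (1 - p^(k+1)) + p^(k+1) (1 - p^(l+1)). *)
transitivity ((1 - p ^+ k.+1) * (qbin (k + l).+1 k * qfact k * qfact l.+1)
  + p ^+ k.+1 * (1 - p ^+ l.+1) * (qbin (k + l).+1 k.+1 * qfact k.+1 * qfact l)).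
  by rewrite !qfactS /=; ring.
have -> : p ^+ (k + l).+2 = p ^+ k.+1 * p ^+ l.+1 by rewrite -exprD addSn addnS.
by rewrite e1 e2; ring.
Qed.

End QBinomial.

(** * The finite triple product and its limit *)

Section Jacobi.

(** Congruence modulo X^(N+1). *)
Definition agree (N : nat) (f g : {poly int}) := forall i, (i <= N)%N -> f`_i = g`_i.

Lemma agreeM N f f' g g' : agree N f f' -> agree N g g' -> agree N (f * g) (f' * g').
Proof.
move=> ff' gg' i le_iN; rewrite !coefM; apply: eq_bigr => j _.
have le_ji : (j <= i)%N by rewrite -ltnS.
by rewrite ff' ?gg' // (leq_trans _ le_iN) ?leq_subr.
Qed.

Lemma agree_sym N f g : agree N f g -> agree N g f.
Proof. by move=> fg i /fg. Qed.

Lemma agree_trans N g f h : agree N f g -> agree N g h -> agree N f h.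
Proof. by move=> fg gh i le_iN; rewrite fg // gh. Qed.

Lemma agree_mulI N (u f g : {poly int}) : u`_0 = 1 -> agree N (u * f) (u * g) -> agree N f g.
Proof.
move=> u0 ufg; elim/ltn_ind => i IHi le_iN; have := ufg i le_iN.
rewrite !coefM !big_ord_recl u0 !mul1r subn0 => /eqP.
rewrite (eq_bigr (fun j : 'I_i => u`_(lift ord0 j) * g`_(i - lift ord0 j))) => [|j _].
  by rewrite (inj_eq (addIr _)) => /eqP.
by rewrite IHi //; rewrite lift0; have := ltn_ord j; lia.
Qed.

Notation p := ('X^6 : {poly int}).

Lemma qfact_agree N k l : (N <= k)%N -> (N <= l)%N -> agree N (qfact p k) (qfact p l).
Proof.
have stab n : (N <= n)%N -> agree N (qfact p n) (qfact p N).
  elim: n => [|n IHn]; first by rewrite leqn0 => /eqP->.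
  rewrite leq_eqVlt => /predU1P[->//|]; rewrite ltnS => le_Nn.
  apply: (agree_trans _ (IHn le_Nn)) => i le_iN.
  rewrite qfactS mulrBr mulr1 coefB -exprM coefMXn.
  by rewrite (_ : (i < _)%N = true) ?subr0 //; lia.
by move=> /stab le_k /stab le_l; apply: agree_trans le_k (agree_sym le_l).
Qed.

Lemma qfact_coef0 k : (qfact p k)`_0 = 1.
Proof.
have := @qfact_agree 0 k 0 isT isT 0%N isT => ->.
by rewrite /qfact big_ord0 coef1.
Qed.

(** By [qbin_fact] the binomial is a quotient of q-factorials, and all q-factorials of index at
    least [N] agree up to degree [N]. *)
Lemma qbin_agree N m k l : (N <= k)%N -> (N <= l)%N -> (N <= m)%N ->
  agree N (qbin p (k + l) k * qfact p m) 1.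
Proof.
move=> Nk Nl Nm; apply: (@agree_mulI _ (qfact p m)); first exact: qfact_coef0.
rewrite mulr1; apply: (@agree_trans _ (qfact p (k + l))); last first.
  by apply: qfact_agree => //; rewrite (leq_trans Nk) ?leq_addr.
rewrite -(qbin_fact p k l) mulrC; do !apply: agreeM => //; exact: qfact_agree.
Qed.

Definition jexp (j : int) : int := 3 * j ^+ 2 - 2 * j.

Lemma jexp_ge j : `|j| <= jexp j.
Proof. by rewrite /jexp expr2; nia. Qed.

(** The q-binomial theorem of order 2n in base q^6, with u = q^(6n) and y = -q. Factors with i >= n
    yield (q; q^6)_n; those with i < n, read backwards, yield (q^5; q^6)_n. *)
Lemma jacobi_finite n :
  qpoch_part int 1 6 n * qpoch_part int 5 6 n
  = \sum_(k < (2 * n).+1)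
      (-1) ^+ (n + k) * 'X^`|jexp (k%:Z - n%:Z)| * qbin p (2 * n) k.
Proof.
have bin2D k : (2 * 'C(k, 2) + k = k * k)%N.
  by elim: k => // k IHk; rewrite binS bin1; lia.
(* The power of q common to both sides: n + 6 C(n, 2) from the factors i < n, 6n^2 from the
   others. *)
pose E := (n + 6 * 'C(n, 2) + 6 * n * n)%N.
have signs m : \prod_(i < m) (- 'X^(1 + 6 * i)) = (-1) ^+ m * 'X^(m + 6 * 'C(m, 2)) :> {poly int}.
  elim: m => [|m IHm]; first by rewrite big_ord0 mulr1.
  have -> : (m.+1 + 6 * 'C(m.+1, 2) = (m + 6 * 'C(m, 2)) + (1 + 6 * m))%N.
    by rewrite binS bin1; lia.
  by rewrite big_ord_recr IHm [X in _ = _ * X]exprD [(-1) ^+ m.+1]exprS /=; ring.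
have lhs : \prod_(i < n + n) (p ^+ n + (- 'X) * p ^+ i)
    = 'X^E * ((-1) ^+ n * (qpoch_part int 1 6 n * qpoch_part int 5 6 n)).
  rewrite big_split_ord /=.
  have -> : \prod_(i < n) (p ^+ n + - 'X * p ^+ i)
      = \prod_(i < n) (- 'X^(1 + 6 * i)) * qpoch_part int 5 6 n.
    have -> : qpoch_part int 5 6 n = \prod_(i < n) (1 - 'X^(6 * (n - i) - 1)).
      rewrite /qpoch_part (reindex_inj rev_ord_inj); apply: eq_bigr => i _.
      by congr (1 - 'X^_); have := ltn_ord i; rewrite /=; lia.
    rewrite -big_split /=; apply: eq_bigr => i _.
    have -> : p ^+ n = 'X^(1 + 6 * i) * 'X^(6 * (n - i) - 1).
      by rewrite -exprM -exprD; congr 'X^_; have := ltn_ord i; lia.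
    by rewrite [p ^+ i](_ : _ = 'X^(6 * i)) -?exprM // add1n exprS; ring.
  have -> : \prod_(i < n) (p ^+ n + - 'X * p ^+ (n + i))
      = (p ^+ n) ^+ n * qpoch_part int 1 6 n.
    have -> : (p ^+ n) ^+ n = \prod_(i < n) p ^+ n by rewrite prodr_const card_ord.
    rewrite /qpoch_part -big_split /=; apply: eq_bigr => i _.
    by rewrite [p ^+ (n + i)]exprD -[p ^+ i]exprM add1n [X in 1 - X]exprS; ring.
  by rewrite signs /E ['X^(_ + 6 * n * n)]exprD -!exprM mulnA; ring.
have := qbinomial p (n + n) (p ^+ n) (- 'X).
rewrite lhs.
have -> : \sum_(k < (n + n).+1)
      qbin p (n + n) k * p ^+ 'C(k, 2) * (- 'X) ^+ k * p ^+ n ^+ (n + n - k)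
  = 'X^E * \sum_(k < (n + n).+1) (-1) ^+ k * 'X^`|jexp (k%:Z - n%:Z)| * qbin p (n + n) k.
  rewrite mulr_sumr; apply: eq_bigr => k _.
  have expE : (6 * 'C(k, 2) + k + 6 * n * (n + n - k) = E + `|jexp (k%:Z - n%:Z)|)%N.
    have le_k : (k <= n + n)%N by rewrite -ltnS.
    have := jexp_ge (k%:Z - n%:Z); have := bin2D k; have := bin2D n.
    by rewrite /E /jexp expr2; nia.
  transitivity ((-1) ^+ k * ('X^(6 * 'C(k, 2)) * 'X^k * 'X^(6 * n * (n + n - k)))
    * qbin p (n + n) k).
    by rewrite [(- 'X) ^+ k]exprNn -!exprM !mulnA; ring.
  by rewrite -!exprD expE exprD; ring.
move/(mulfI (monic_neq0 (monicXn _ _))) => finE.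
have := congr1 ( *%R ((-1) ^+ n)) finE; rewrite signrMK mulr_sumr mul2n -addnn => ->.
by apply: eq_bigr => k _; rewrite [(-1) ^+ (n + k)]exprD; ring.
Qed.

Lemma qpoch66 n : qpoch_part int 6 6 n = qfact p n.
Proof.
by apply: eq_bigr => i _; rewrite -exprM mulnS.
Qed.

(** Even j = 2k give the exponents of [pent] at q^8 with sign +, odd j = 2k + 1 those of q times
    [oct] at q^4 with sign -. *)
Lemma jacobi_coef (N n : nat) : (N <= n)%N ->
  (fps_dil 8 (pent int) - fps_q int * fps_dil 4 (oct int)) N
  = \sum_(j <- zball n) (-1) ^+ `|j|%N * (jexp j == N%:Z)%:R.
Proof.
move=> le_Nn.
pose ev := [seq (j %/ 2)%Z | j <- [seq j <- zball n | (j %% 2)%Z == 0]].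
pose od := [seq (j %/ 2)%Z | j <- [seq j <- zball n | (j %% 2)%Z != 0]].
rewrite fps_coefD fps_coefN.
rewrite (@counts_coef _ _ _ _ _ ev (counts_dil _ (counts_pent int))) //; first last.
- move=> i iN; apply/mapP; exists (2 * i); last lia.
  rewrite mem_filter mem_zball; apply/andP; split; first by lia.
  by have := pent_expE i; nia.
- rewrite map_inj_in_uniq ?filter_uniq ?uniq_zball // => i j.
  by rewrite !mem_filter => /andP[i2 _] /andP[j2 _]; lia.
have oddC : counts (fun i => 1%:Z + 4%:Z * (3 * i ^+ 2 + 2 * i)) (fps_q int * fps_dil 4 (oct int)).
  by rewrite -[fps_q int]expr1; apply: counts_ext (counts_shift 1 (counts_dil _ (counts_oct int))).
rewrite (@counts_coef _ _ _ _ _ od oddC) //; first last.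
- move=> i iN; apply/mapP; exists (2 * i + 1); last lia.
  rewrite mem_filter mem_zball; apply/andP; split; first by lia.
  by move: iN; rewrite expr2; nia.
- rewrite map_inj_in_uniq ?filter_uniq ?uniq_zball // => i j.
  by rewrite !mem_filter => /andP[i2 _] /andP[j2 _]; lia.
rewrite [RHS](bigID (fun j => (j %% 2)%Z == 0)) /= -sumrN.
congr (_ + _); rewrite big_map big_filter; apply: eq_bigr => j j2.
- have [k jE] : exists k : int, j = 2 * k by exists (j %/ 2)%Z; lia.
  have -> : (j %/ 2)%Z = k by lia.
  rewrite -signr_odd (_ : odd _ = false) ?mul1r; last by lia.
  congr (_ == _)%:R; have := pent_expE k; rewrite jE /jexp.
  by move: (pent_exp _) => u; rewrite expr2; lia.
- have [k jE] : exists k : int, j = 2 * k + 1 by exists (j %/ 2)%Z; lia.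
  have -> : (j %/ 2)%Z = k by lia.
  rewrite -signr_odd (_ : odd _ = true) ?mulN1r; last by lia.
  by congr (- (_ == _)%:R); rewrite jE /jexp; ring.
Qed.

Theorem jacobi_product :
  qpoch int 1 6 * qpoch int 5 6 * qpoch int 6 6
  = fps_dil 8 (pent int) - fps_q int * fps_dil 4 (oct int).
Proof.
(* With this [n], every |j| <= N leaves both n + j and n - j at least N, as [qbin_agree]
   requires. *)
apply/fpsP => N; pose n := (2 * N).+1.
rewrite (@jacobi_coef N n) /n; last by lia.
rewrite -/n -[LHS]/(fps_mul (fps_mul (qpoch int 1 6) (qpoch int 5 6)) (qpoch int 6 6) N).
rewrite (@fps_mul_coef _ _ _ (qpoch_part int 1 6 n * qpoch_part int 5 6 n) (qpoch_part int 6 6 n)).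
- rewrite jacobi_finite mulr_suml coef_sum /zball big_map.
  rewrite -[in RHS](subn0 (2 * n).+1) -/(index_iota _ _) big_mkord.
  apply: eq_bigr => k _.
  rewrite -!mulrA; set j := k%:Z - n%:Z.
  have -> : (-1) ^+ (n + k) = (-1) ^+ `|j|%N :> {poly int}.
    by rewrite -signr_odd -[RHS]signr_odd; congr (_ ^+ nat_of_bool _); rewrite /j; lia.
  rewrite -[(-1) ^+ `|j|%N]/((-1) ^+ `|j|%N : {poly int}).
  rewrite (_ : ((-1) ^+ `|j|%N : {poly int}) = ((-1) ^+ `|j|%N)%:P); last first.
    by rewrite polyC_exp polyCN.
  rewrite coefCM coefXnM; congr (_ * _); have := jexp_ge j => jge.
  case: ltnP => [ltNj|le_jN]; first by case: eqP => //; lia.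
  have le_k : (k <= 2 * n)%N by rewrite -ltnS.
  have le_jN' : (`|j| <= N)%N by lia.
  have agr : agree N (qbin p (2 * n) k * qfact p n) 1.
    have := @qbin_agree N n k (2 * n - k)%N; rewrite subnKC //.
    by apply; rewrite /j /n in le_jN' *; lia.
  rewrite qpoch66 agr ?leq_subr // coef1.
  by congr (nat_of_bool _)%:R; lia.
- move=> i le_iN; symmetry; apply: fps_mul_coef => l le_li; rewrite qpoch_stable // /n; lia.
- by move=> i le_iN; rewrite qpoch_stable // /n; lia.
Qed.

End Jacobi.

(** * Algebra of the degree 4 extension, modulo 16 *)

Lemma mod16 (K : comNzRingType) (char16 : 16%:R = 0 :> K) (k x y : K) :
  x = y + 16 * k -> x = y.
Proof. by move=> ->; rewrite char16 mul0r addr0. Qed.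
Arguments mod16 {K} char16 k {x y}.

(* X1, X2, X3 stand for x s, x^2 s, x^3 s, and kappa for 1 / (1 + x), in the notation of the
   header.  In the proofs modulo 16 the explicit argument of [mod16] is the quotient by 16. *)
Section Algebra.
Variable K : comNzRingType.

(* m, g, c, h are the values at q^2 of A, G, C, H. *)
Lemma descent_step (q A C G H m g c h : K) :
    G * C = m ^+ 2 + q * g ^+ 2 -> A * H = g * m ->
    A ^+ 2 = m * c + 2 * (q ^+ 2 * (g * h)) ->
    G ^+ 2 = g * c + 2 * (q * (m * h)) ->
  A * G * (C * H * (A ^+ 4 - q * G ^+ 4)
             - A * G * (G ^+ 2 * C ^+ 2 - 4 * q * A ^+ 2 * H ^+ 2))
  = q * (- 2 * (m ^+ 2 - q * g ^+ 2) * (c * h * (m ^+ 4 - q ^+ 2 * g ^+ 4)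
             - m * g * (g ^+ 2 * c ^+ 2 - 4 * q ^+ 2 * m ^+ 2 * h ^+ 2))).
Proof.
move=> GC AH A2 G2.
transitivity (G * C * (A * H) * ((A ^+ 2) ^+ 2 - q * (G ^+ 2) ^+ 2)
  - A ^+ 2 * G ^+ 2 * ((G * C) ^+ 2 - 4 * q * (A * H) ^+ 2)); first by ring.
by rewrite GC AH A2 G2; ring.
Qed.

Variables s X1 X2 X3 : K.
Hypotheses (X11 : X1 * X1 = s * X2) (X12 : X1 * X2 = s * X3) (X13 : X1 * X3 = X2 * X2).
Hypotheses (X22 : X2 * X2 * (1 + 4 * s) = s * (1 + s))
  (X23 : X2 * X3 * (1 + 4 * s) = X1 * (1 + s))
  (X33 : X3 * X3 * (1 + 4 * s) = X2 * (1 + s)).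

(** [tau] is the value to be proved for t E^2; it satisfies the same quadratic equation as t E^2,
    see [tmodE]. *)
Lemma modular_eq (tau := s - X1 + X2 + (1 + 4 * s) * X3) (E := 1 + 2 * X1) :
  tau * (E ^+ 2 + 2 * tau) = E * ((1 + 2 * s) * (s + 3 * X1 + 3 * X2 + X3)).
Proof.
rewrite /tau /E.
apply/eqP; rewrite -subr_eq0; apply/eqP.
(* An explicit combination of the relations among the Xi certifies the identity. *)
transitivity ((4 * (s - X1 + X2 + (1 + 4 * s) * X3) - 8 - 12 * s) * (X1 * X1 - s * X2)
  - (6 + 16 * s) * (X1 * X2 - s * X3) - 2 * (1 + 2 * s) * (X1 * X3 - X2 * X2)
  + 4 * (1 + s) * (X2 * X3 * (1 + 4 * s) - X1 * (1 + s))
  + 2 * (1 + 4 * s) * (X3 * X3 * (1 + 4 * s) - X2 * (1 + s))); first by ring.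
by rewrite X11 X12 X13 X23 X33; ring.
Qed.

Hypothesis char16 : 16%:R = 0 :> K.

Definition nf (a0 a1 a2 a3 : K) := a0 + a1 * X1 + a2 * X2 + a3 * X3.

(** Modulo 16 the inverse of 1 + 4s is 1 - 4s, so [c] stands for (1 + s)/(1 + 4s). *)
Lemma nfM a0 a1 a2 a3 b0 b1 b2 b3 (c := 1 - 3 * s - 4 * s ^+ 2) :
  nf a0 a1 a2 a3 * nf b0 b1 b2 b3
  = nf (a0 * b0 + (a1 * b3 + a2 * b2 + a3 * b1) * s * c)
       (a0 * b1 + a1 * b0 + (a2 * b3 + a3 * b2) * c)
       (a0 * b2 + a2 * b0 + a1 * b1 * s + a3 * b3 * c)
       (a0 * b3 + a3 * b0 + (a1 * b2 + a2 * b1) * s).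
Proof.
have unit4 x y : x * (1 + 4 * s) = y -> x = y * (1 - 4 * s).
  by move=> <-; apply: (mod16 char16 (s ^+ 2 * x)); ring.
have X22c : X2 * X2 = s * c by rewrite (unit4 _ _ X22) /c; ring.
have X23c : X2 * X3 = X1 * c by rewrite (unit4 _ _ X23) /c; ring.
have X33c : X3 * X3 = X2 * c by rewrite (unit4 _ _ X33) /c; ring.
rewrite /nf; transitivity (a0 * b0 + (a0 * b1 + a1 * b0) * X1
  + (a0 * b2 + a2 * b0) * X2 + (a0 * b3 + a3 * b0) * X3
  + a1 * b1 * (X1 * X1) + (a1 * b2 + a2 * b1) * (X1 * X2)
  + (a1 * b3 + a3 * b1) * (X1 * X3) + a2 * b2 * (X2 * X2)
  + (a2 * b3 + a3 * b2) * (X2 * X3) + a3 * b3 * (X3 * X3)); first by ring.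
by rewrite X11 X12 X13 X22c X23c X33c; ring.
Qed.

Variables kappa t : K.
Hypothesis kappaE : kappa * (1 - 4 * s ^+ 2) = - (1 + 4 * s) * (s - X1 + X2 - X3).
Hypothesis tE : t * (1 + 2 * X1) ^+ 2 = s - X1 + X2 + (1 + 4 * s) * X3.

Lemma kappa_nf : kappa = nf (- s - 4 * s ^+ 2 - 4 * s ^+ 3) (1 + 4 * s + 4 * s ^+ 2)
    (- 1 - 4 * s - 4 * s ^+ 2) (1 + 4 * s + 4 * s ^+ 2).
Proof.
have -> : kappa = kappa * (1 - 4 * s ^+ 2) * (1 + 4 * s ^+ 2).
  by apply: (mod16 char16 (s ^+ 4 * kappa)); ring.
rewrite kappaE /nf; apply: (mod16 char16 (- s ^+ 3 * (s - X1 + X2 - X3))); ring.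
Qed.

(** Modulo 16 the inverse of 1 + 2 X1 is 1 - 2 X1 + 4 X1^2 - 8 X1^3, which is
    [nf 1 (- 2) (4 * s) (- 8 * s ^+ 2)]; [e1] and [e2] multiply by it twice. *)
Lemma t_nf : t = nf (- 3 * s + 8 * s ^+ 2 - 4 * s ^+ 3) (- 1 + 8 * s - 4 * s ^+ 2)
    (1 + 4 * s - 4 * s ^+ 2) (1 + 4 * s ^+ 2).
Proof.
have e1 : nf s (- 1) 1 (1 + 4 * s)
    * nf 1 (- 2) (4 * s) (- 8 * s ^+ 2)
  = nf (- s + 2 * s ^+ 2 - 4 * s ^+ 3 + 8 * s ^+ 4) (- 1 + 2 * s - 4 * s ^+ 2 + 8 * s ^+ 3)
      (1 + 2 * s - 4 * s ^+ 2 + 8 * s ^+ 3) (1 + 2 * s - 4 * s ^+ 2 + 8 * s ^+ 3).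
  by rewrite nfM; congr nf;
    [ apply: (mod16 char16 (2 * s ^+ 3 - s ^+ 4 - 2 * s ^+ 5)); ring
    | apply: (mod16 char16 (- 3 * s ^+ 3 - 2 * s ^+ 4)); ring
    | apply: (mod16 char16 (- s ^+ 3 + 8 * s ^+ 4 + 8 * s ^+ 5)); ring
    | apply: (mod16 char16 (- s ^+ 3)); ring].
have e2 : nf (- s + 2 * s ^+ 2 - 4 * s ^+ 3 + 8 * s ^+ 4)
    (- 1 + 2 * s - 4 * s ^+ 2 + 8 * s ^+ 3) (1 + 2 * s - 4 * s ^+ 2 + 8 * s ^+ 3)
    (1 + 2 * s - 4 * s ^+ 2 + 8 * s ^+ 3)
    * nf 1 (- 2) (4 * s) (- 8 * s ^+ 2)
  = nf (- 3 * s + 8 * s ^+ 2 - 4 * s ^+ 3) (- 1 + 8 * s - 4 * s ^+ 2) (1 + 4 * s - 4 * s ^+ 2)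
      (1 + 4 * s ^+ 2).
  by rewrite nfM; congr nf;
    [ apply: (mod16 char16 (2 * s ^+ 3 - 7 * s ^+ 4 + 7 * s ^+ 5 - 4 * s ^+ 6 - 4 * s ^+ 7
        + 16 * s ^+ 8)); ring
    | apply: (mod16 char16 (- s ^+ 2 - 2 * s ^+ 3 + 9 * s ^+ 4 - 8 * s ^+ 5 - 4 * s ^+ 6
        + 16 * s ^+ 7)); ring
    | apply: (mod16 char16 (- s ^+ 2 + 2 * s ^+ 3 + 5 * s ^+ 4 - 4 * s ^+ 5 + 4 * s ^+ 6
        + 16 * s ^+ 7)); ring
    | apply: (mod16 char16 (- s ^+ 2 + 2 * s ^+ 3 - 3 * s ^+ 4 + 4 * s ^+ 5 - 4 * s ^+ 6)); ring].
rewrite -e2 -e1.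
have -> : nf s (- 1) 1 (1 + 4 * s) = t * (1 + 2 * X1) ^+ 2 by rewrite tE /nf; ring.
have -> : nf 1 (- 2) (4 * s) (- 8 * s ^+ 2)
    = 1 - 2 * X1 + 4 * X1 ^+ 2 - 8 * X1 ^+ 3.
  have X1_3 : X1 ^+ 3 = s ^+ 2 * X3.
    by rewrite exprS expr2 X11 mulrCA X12; ring.
  by rewrite X1_3 [X1 ^+ 2]expr2 X11 /nf; ring.
by apply: (mod16 char16 (t * (2 * X1 ^+ 4 - 16 * X1 ^+ 8))); ring.
Qed.

(** In these products with kappa the first entry is the x^0-part sought; the other entries of this
    one feed the computation of the next powers of t. *)
Lemma kappa_t1 : kappa * t
  = nf (- s + 6 * s ^+ 2 + 8 * s ^+ 3) (2 * s + 4 * s ^+ 2) (1 + 2 * s + 8 * s ^+ 2)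
      (- 2 * s - 4 * s ^+ 2).
Proof.
by rewrite kappa_nf t_nf nfM; congr nf;
    [ apply: (mod16 char16 (s ^+ 3 - 2 * s ^+ 4 - 10 * s ^+ 5 - 10 * s ^+ 6 - 4 * s ^+ 7)); ring
    | apply: (mod16 char16 (- s ^+ 2 - 4 * s ^+ 3 - s ^+ 4 + 10 * s ^+ 5 + 8 * s ^+ 6)); ring
    | apply: (mod16 char16 (- s ^+ 2 - 2 * s ^+ 3 - 4 * s ^+ 4 - 6 * s ^+ 5 - 4 * s ^+ 6)); ring
    | apply: (mod16 char16 (- s ^+ 4 - 2 * s ^+ 5)); ring].
Qed.

Lemma kappa_t2 : kappa * t * t
  = nf (s - 6 * s ^+ 2 + 8 * s ^+ 3) (1 - 2 * s + 8 * s ^+ 2) (- 6 * s + 4 * s ^+ 2)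
      (- 2 * s + 4 * s ^+ 2).
Proof.
by rewrite kappa_t1 t_nf nfM; congr nf;
    [ apply: (mod16 char16 (s ^+ 2 - 4 * s ^+ 3 - s ^+ 4 - 4 * s ^+ 6)); ring
    | apply: (mod16 char16 (- 2 * s ^+ 2 + 3 * s ^+ 3
        + 7 * s ^+ 4 - 12 * s ^+ 5 - 12 * s ^+ 6)); ring
    | apply: (mod16 char16 (3 * s ^+ 3 + 7 * s ^+ 4 + 4 * s ^+ 6)); ring
    | apply: (mod16 char16 (s ^+ 2 + s ^+ 3 + 4 * s ^+ 4)); ring].
Qed.

Lemma t_sqr_nf : t * t
  = nf (- s + 4 * s ^+ 2 + 4 * s ^+ 3) (2 + 8 * s) (1 + 8 * s - 4 * s ^+ 2) (8 * s + 8 * s ^+ 2).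
Proof.
by rewrite t_nf nfM; congr nf;
    [ apply: (mod16 char16 (2 * s ^+ 2 - 8 * s ^+ 3 + 3 * s ^+ 4 - 9 * s ^+ 5 - 4 * s ^+ 6
        + 4 * s ^+ 7)); ring
    | apply: (mod16 char16 (- 6 * s ^+ 2 + 10 * s ^+ 3 - 16 * s ^+ 4 + 8 * s ^+ 6)); ring
    | apply: (mod16 char16 (- s - s ^+ 2 + 8 * s ^+ 3 - 11 * s ^+ 4 - 4 * s ^+ 6)); ring
    | apply: (mod16 char16 (- s + s ^+ 2 + 2 * s ^+ 3 - 2 * s ^+ 4)); ring].
Qed.

Lemma kappa_t3 : kappa * t * (t * t)
  = nf (s + 4 * s ^+ 2 - 4 * s ^+ 3 + 8 * s ^+ 4) (4 * s + 4 * s ^+ 2 + 8 * s ^+ 3)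
      (- 2 * s + 4 * s ^+ 2 + 8 * s ^+ 3) (2 * s + 8 * s ^+ 2 + 8 * s ^+ 3).
Proof.
by rewrite kappa_t1 t_sqr_nf nfM; congr nf;
    [ apply: (mod16 char16 (- s ^+ 3 + s ^+ 4 - 13 * s ^+ 5 - 16 * s ^+ 6)); ring
    | apply: (mod16 char16 (- s ^+ 2 + 5 * s ^+ 3 - s ^+ 4 - 28 * s ^+ 5 - 20 * s ^+ 6)); ring
    | apply: (mod16 char16 (- s ^+ 2 + 5 * s ^+ 3 + 18 * s ^+ 4 + 18 * s ^+ 5 + 8 * s ^+ 6)); ring
    | apply: (mod16 char16 (5 * s ^+ 3 + 11 * s ^+ 4 + 2 * s ^+ 5)); ring].
Qed.

End Algebra.

(** * The Hauptmodul *)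

Section Modular.
Variable R : comUnitRingType.

Notation q := (fps_q R).
Notation dil := (@fps_dil R).
Notation A := (dil 2 (pent R)).
Notation C := (dil 3 (phi R)).
Notation G := (oct R).
Notation H := (dil 6 (psi R)).

Lemma fps_dil_nat k n : (0 < k)%N -> dil k n%:R = n%:R.
Proof. by move=> k_gt0; rewrite fps_dilMn ?fps_dil1. Qed.

Definition dilE := (fps_dilD, fps_dilN, fps_dilM, fps_dilX, fps_dilq, fps_dil1,
  fps_dil_nat, fps_dil_dil).

Definition coef0E := (fps_coef0M, fps_coef0X, fps_dil_coef0, pent0, oct0, phi0, psi0,
  expr1n, mulr1).

(** The factor q makes each coefficient of f depend only on earlier ones, so all vanish by strong
    induction. *)
Lemma fps_descent (u v f : fps R) : u 0%N = 1 -> u * f = q * (v * dil 2 f) -> f = 0.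
Proof.
move=> u0 ufE; have {ufE} fE : f = q * (fps_inv u * v * dil 2 f).
  apply: (fps_mulI u0); rewrite ufE.
  transitivity (u * fps_inv u * (q * (v * dil 2 f))); last by ring.
  by rewrite fps_divr // mul1r.
apply/fpsP; elim/ltn_ind => n IHn; rewrite fE fps_coefqM.
case: n IHn => // n IHn; rewrite fps_coefM big1 // => i _.
rewrite /fps_dil; case: ifP => _; last by rewrite mulr0.
by rewrite IHn ?mulr0 // ltnS (leq_trans (leq_div _ _)) ?leq_subr.
Qed.

Lemma quintic_relation :
  C * H * (A ^+ 4 - q * G ^+ 4) = A * G * (G ^+ 2 * C ^+ 2 - 4 * q * A ^+ 2 * H ^+ 2).
Proof.
apply/eqP; rewrite -subr_eq0; apply/eqP.
apply: (@fps_descent (A * G) (- 2 * (dil 4 (pent R) ^+ 2 - q * dil 2 G ^+ 2))).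
  by rewrite !coef0E.
have AH : A * H = dil 2 G * dil 4 (pent R).
  by have := congr1 (dil 2) (pent_psi R); rewrite !dilE.
have A2 := congr1 (dil 2) (pent_sqr R); rewrite !dilE // in A2.
rewrite (descent_step (oct_phi R) AH A2 (oct_sqr R)).
by rewrite !dilE //; ring.
Qed.

(* Locked, so that rewriting with [dilE] does not expand them. *)
Definition hquo : fps R := locked (H * fps_inv C).
Definition zquo : fps R := locked (A * fps_inv G).
Definition tmod : fps R := locked (q * hquo * (G * fps_inv A)).

Lemma pent2V : A * fps_inv A = 1. Proof. by apply: fps_divr. Qed.
Lemma phi3V : C * fps_inv C = 1. Proof. by apply: fps_divr. Qed.
Lemma octV : G * fps_inv G = 1. Proof. by apply: fps_divr. Qed.

Lemma tmod_AC : tmod * (A * C) = q * (G * H).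
Proof.
transitivity (q * (G * H) * (A * fps_inv A) * (C * fps_inv C)).
  by rewrite /tmod /hquo -!lock; ring.
by rewrite pent2V phi3V !mulr1.
Qed.

(** [quintic_relation] divided by its denominators. As t z = q h, at q^4 it reads s x^4 (1 + 4s) = 1
    + s. *)
Lemma hquo_zquo3 : hquo * zquo ^+ 3 * (1 + 4 * tmod) = 1 + tmod.
Proof.
apply: (@fps_mulI _ (C ^+ 2 * A * G ^+ 3)).
  by rewrite !coef0E.
transitivity (A ^+ 3 * H * (C * fps_inv C) * (G * fps_inv G) ^+ 3 * (A * C + 4 * (tmod * (A * C)))).
  by rewrite /hquo /zquo -!lock; ring.
rewrite phi3V octV tmod_AC.
transitivity (G ^+ 3 * C * (A * C + tmod * (A * C))); last by ring.
rewrite tmod_AC; apply/eqP; rewrite -subr_eq0; apply/eqP.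
transitivity (C * H * (A ^+ 4 - q * G ^+ 4)
  - A * G * (G ^+ 2 * C ^+ 2 - 4 * q * A ^+ 2 * H ^+ 2)); first by ring.
by rewrite quintic_relation subrr.
Qed.

(** [pent_sqr] reads AC + 2qGH = F^2, which accounts for 1 + 2t; then F^2 C H = (G A)^2 by [psi_sqr]
    and [pent_psi]. *)
Lemma tmod_cubic : tmod * (1 + 2 * tmod) * C ^+ 3 = q * G ^+ 3.
Proof.
apply: (@fps_mulI _ (A ^+ 2)); first by rewrite !coef0E.
have psi2 : dil 3 (psi R) ^+ 2 = C * H.
  by have := congr1 (dil 3) (psi_sqr R); rewrite !dilE.
transitivity (C * (tmod * (A * C)) * (A * C + 2 * (tmod * (A * C)))); first by ring.
rewrite tmod_AC -pent_sqr.
transitivity (q * G * (pent R ^+ 2 * (C * H))); first by ring.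
by rewrite -psi2 -exprMn pent_psi; ring.
Qed.

Notation s := (dil 4 tmod).
Notation h4 := (dil 4 hquo).
Notation z4 := (dil 4 zquo).

(* x s, x^2 s and x^3 s *)
Definition xq1 : fps R := q ^+ 3 * h4.
Definition xq2 : fps R := q ^+ 2 * h4 * z4.
Definition xq3 : fps R := q * h4 * z4 ^+ 2.

Lemma tmod_zquo : tmod * zquo = q * hquo.
Proof.
transitivity (q * hquo * (G * fps_inv G) * (A * fps_inv A)).
  by rewrite /tmod /zquo -!lock; ring.
by rewrite pent2V octV !mulr1.
Qed.

Lemma zquo_oct : zquo * G = A.
Proof. by rewrite /zquo -lock mulrAC -mulrA octV mulr1. Qed.

Lemma s_zquo : s * z4 = q * xq1.
Proof. by rewrite -fps_dilM // tmod_zquo fps_dilM // fps_dilq // /xq1; ring. Qed.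

Lemma hquo_zquo_s : h4 * z4 ^+ 3 * (1 + 4 * s) = 1 + s.
Proof. by have := congr1 (dil 4) hquo_zquo3; rewrite !dilE. Qed.

Lemma xq11 : xq1 * xq1 = s * xq2.
Proof.
transitivity (q ^+ 2 * h4 * (s * z4)); last by rewrite /xq2; ring.
by rewrite s_zquo /xq1; ring.
Qed.
Lemma xq12 : xq1 * xq2 = s * xq3.
Proof.
transitivity (q * h4 * z4 * (s * z4)); last by rewrite /xq3; ring.
by rewrite s_zquo /xq1 /xq2; ring.
Qed.
Lemma xq13 : xq1 * xq3 = xq2 * xq2.
Proof. by rewrite /xq1 /xq2 /xq3; ring. Qed.

Lemma xq22 : xq2 * xq2 * (1 + 4 * s) = s * (1 + s).
Proof.
rewrite -hquo_zquo_s; transitivity (s * z4 * h4 * z4 ^+ 2 * (1 + 4 * s)); last by ring.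
by rewrite s_zquo /xq1 /xq2; ring.
Qed.
Lemma xq23 : xq2 * xq3 * (1 + 4 * s) = xq1 * (1 + s).
Proof. by rewrite -hquo_zquo_s /xq1 /xq2 /xq3; ring. Qed.
Lemma xq33 : xq3 * xq3 * (1 + 4 * s) = xq2 * (1 + s).
Proof. by rewrite -hquo_zquo_s /xq2 /xq3; ring. Qed.

Lemma oct_zquo : G = dil 4 G * (z4 + q).
Proof.
rewrite {1}oct_dissect mulrDr [q * _]mulrC; congr (_ + _).
by rewrite mulrC -fps_dilM // zquo_oct dilE.
Qed.

Lemma phi_xq1 : C = dil 4 C * (1 + 2 * xq1).
Proof.
have := congr1 (dil 3) (phi_dissect R); rewrite !dilE // => ->.
have HE : dil 24 (psi R) = h4 * dil 12 (phi R).
  have : dil 4 H = dil 4 (hquo * C).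
    by congr (dil _ _); rewrite /hquo -lock -mulrA [fps_inv _ * _]mulrC phi3V mulr1.
  by rewrite !dilE.
by rewrite HE /xq1; ring.
Qed.

(* 1 / (1 + x) *)
Definition kap : fps R := q * dil 4 G * fps_inv G.

Lemma kap_oct : kap * G = q * dil 4 G.
Proof. by rewrite /kap -mulrA [fps_inv _ * _]mulrC octV mulr1. Qed.

(** This is 1/(1 + x) = (1 - x + x^2 - x^3)/(1 - x^4) with x^4 replaced by its value in s; z4 + q is
    q(1 + x). *)
Lemma kapE : kap * (1 - 4 * s ^+ 2) = - (1 + 4 * s) * (s - xq1 + xq2 - xq3).
Proof.
have z4q0 : (z4 + q) 0%N = 1.
  by rewrite fps_coefD /fps_q /= addr0 fps_dil_coef0 /zquo -lock fps_coef0M mul1r /fps_inv /= invr1.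
have kz : kap * (z4 + q) = q.
  apply: (@fps_mulI _ (dil 4 G)); first by [].
  by rewrite mulrCA -oct_zquo kap_oct mulrC.
apply: (fps_mulI z4q0).
transitivity (kap * (z4 + q) * (1 - 4 * s ^+ 2)); first by ring.
rewrite kz; transitivity (- (1 + 4 * s) * (q * s + s * z4 - q * xq1
  + (q * xq2 - xq1 * z4) + (xq2 * z4 - q * xq3) - xq3 * z4)); last by ring.
rewrite s_zquo; have -> : xq1 * z4 = q * xq2 by rewrite /xq1 /xq2; ring.
have -> : xq2 * z4 = q * xq3 by rewrite /xq3 /xq2; ring.
have -> : xq3 * z4 = q * (h4 * z4 ^+ 3) by rewrite /xq3; ring.
transitivity (q * (h4 * z4 ^+ 3 * (1 + 4 * s)) - q * s * (1 + 4 * s)); last by ring.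
by rewrite hquo_zquo_s; ring.
Qed.

Lemma tmodE : tmod * (1 + 2 * xq1) ^+ 2 = s - xq1 + xq2 + (1 + 4 * s) * xq3.
Proof.
have tmod0 : tmod 0%N = 0 by rewrite /tmod -lock !fps_coef0M !mul0r.
(* [tmod_cubic] at q divided by [tmod_cubic] at q^4, using [phi_xq1] and [oct_zquo]. *)
have cubic : tmod * (1 + 2 * tmod) * (1 + 2 * xq1) ^+ 3
    = (1 + 2 * s) * (s + 3 * xq1 + 3 * xq2 + xq3).
  apply: (@fps_qXI _ 3); apply: (@fps_mulI _ (dil 4 C ^+ 3)).
    by rewrite !coef0E.
  transitivity (q ^+ 3 * (tmod * (1 + 2 * tmod) * (dil 4 C * (1 + 2 * xq1)) ^+ 3)); first by ring.
  rewrite -phi_xq1 tmod_cubic oct_zquo.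
  transitivity (q ^+ 4 * dil 4 G ^+ 3 * (z4 + q) ^+ 3); first by ring.
  have <- : s * (1 + 2 * s) * dil 4 C ^+ 3 = q ^+ 4 * dil 4 G ^+ 3.
    by have := congr1 (dil 4) tmod_cubic; rewrite !dilE.
  transitivity (dil 4 C ^+ 3 * (1 + 2 * s) * (z4 ^+ 2 * (s * z4) + 3 * q * z4 * (s * z4)
     + 3 * q ^+ 2 * (s * z4) + q ^+ 3 * s)); first by ring.
  by rewrite s_zquo /xq1 /xq2 /xq3; ring.
have := modular_eq xq11 xq12 xq13 xq23 xq33.
set tau := _ + _ * xq3; set E := 1 + 2 * xq1 => tauE.
(* t E^2 and tau are both roots of y(E^2 + 2y) = const; the difference of the two equations is their
   difference times this factor, which is invertible. *)
have unit_factor : (E ^+ 2 + 2 * (tmod * E ^+ 2 + tau)) 0%N = 1.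
  have xq10 : xq1 0%N = 0 by rewrite /xq1 exprS -mulrA fps_coef0M mul0r.
  have xq20 : xq2 0%N = 0 by rewrite /xq2 exprS -!mulrA fps_coef0M mul0r.
  have xq30 : xq3 0%N = 0 by rewrite /xq3 -!mulrA fps_coef0M mul0r.
  rewrite /tau /E !(fps_coefD, fps_coefN, fps_coef0M, fps_coef0X, xq10, xq20, xq30).
  by rewrite fps_dil_coef0 tmod0 !(mulr0, mul0r, addr0, oppr0, fps_coef1, expr1n).
apply/eqP; rewrite -subr_eq0; apply/eqP; apply: (fps_mulI unit_factor).
rewrite mulr0; transitivity (E * (tmod * (1 + 2 * tmod) * E ^+ 3) - tau * (E ^+ 2 + 2 * tau)).
  by ring.
by rewrite cubic tauE subrr.
Qed.

End Modular.

(** * Dissection of the generating function *)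

Section Dissection.
Variable R : comUnitRingType.
Notation q := (fps_q R).
Notation dil := (@fps_dil R).

Definition dis (r : nat) (f : fps R) : fps R := fun n => f (4 * n + r)%N.

Lemma disD r f g : dis r (f + g) = dis r f + dis r g.
Proof. by []. Qed.

Lemma dis_qX r i f : (r < 4)%N -> (i < 4)%N ->
  dis r (q ^+ i * dil 4 f) = if i == r then f else 0.
Proof.
move=> r4 i4; apply/fpsP => n; rewrite /dis fps_coefqXM /fps_dil.
case: (altP (i =P r)) => [->|ir].
  by rewrite leq_addl addnK dvdn_mulr // mulKn.
case: ifP => // le_i; case: ifP => // /dvdnP[m]; lia.
Qed.

Lemma dis_sum f : f = \sum_(i < 4) q ^+ i * dil 4 (dis i f).
Proof.
apply/fpsP => n; rewrite {1}(divn_eq n 4) mulnC.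
have lt4 : (n %% 4 < 4)%N by rewrite ltn_mod.
pose g := \sum_(i < 4) q ^+ i * dil 4 (dis i f).
rewrite [in RHS](divn_eq n 4) [in RHS]mulnC.
rewrite -[LHS]/(dis (n %% 4)%N f (n %/ 4)%N) -[RHS]/(dis (n %% 4)%N g (n %/ 4)%N).
rewrite /g !big_ord_recl big_ord0 !disD.
by move: (n %% 4)%N lt4 => [|[|[|[|r]]]] // _; rewrite !dis_qX //= ?addr0 ?add0r.
Qed.

Lemma dis_dilM r f g : (r < 4)%N -> dis r (f * dil 4 g) = dis r f * g.
Proof.
move=> r4; rewrite {1}[f]dis_sum mulr_suml.
under eq_bigr => i _ do rewrite -mulrA -fps_dilM //.
rewrite !big_ord_recl big_ord0 !disD.
have -> : dis r 0 = 0 by [].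
rewrite !dis_qX //=.
by move: r r4 => [|[|[|[|r]]]] //= _; rewrite ?addr0 ?add0r.
Qed.

Notation G := (oct R).
Notation A := (dil 2 (pent R)).
Notation t := (tmod R).

Hypothesis R16 : 16%:R = 0 :> R.

Lemma fps16 : 16%:R = 0 :> fps R.
Proof. by apply/fpsP => n; rewrite fps_coefMn -mulr_natr R16 mulr0. Qed.

Lemma dis_nat r n f : dis r (n%:R * f) = n%:R * dis r f.
Proof. by apply/fpsP => i; rewrite /dis !mulr_natl !fps_coefMn. Qed.

(** [xq1], [xq2], [xq3] are q^3, q^2, q times series in q^4, so they contribute nothing in residue
    0. *)
Lemma dis_nf (a0 a1 a2 a3 : fps R) :
  dis 0 (nf (xq1 R) (xq2 R) (xq3 R) (dil 4 a0) (dil 4 a1) (dil 4 a2) (dil 4 a3)) = a0.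
Proof.
rewrite /nf /xq1 /xq2 /xq3 !disD.
have -> : dil 4 a1 * (q ^+ 3 * dil 4 (hquo R)) = q ^+ 3 * dil 4 (a1 * hquo R).
  by rewrite fps_dilM //; ring.
have -> : dil 4 a2 * (q ^+ 2 * dil 4 (hquo R) * dil 4 (zquo R))
    = q ^+ 2 * dil 4 (a2 * hquo R * zquo R).
  by rewrite !fps_dilM //; ring.
have -> : dil 4 a3 * (q * dil 4 (hquo R) * dil 4 (zquo R) ^+ 2)
    = q ^+ 1 * dil 4 (a3 * hquo R * zquo R ^+ 2).
  by rewrite !fps_dilM //; ring.
by rewrite -[dil 4 a0]mul1r -[1](expr0 q) !dis_qX //= !addr0.
Qed.

Lemma dis_step (b : fps R) (x y z : nat) :
  q * b * G = x%:R * t + y%:R * t ^+ 2 + z%:R * t ^+ 3 ->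
  q * dis 2 b * G = x%:R * (- t + 6 * t ^+ 2 + 8 * t ^+ 3)
    + y%:R * (t - 6 * t ^+ 2 + 8 * t ^+ 3)
    + z%:R * (t + 4 * t ^+ 2 - 4 * t ^+ 3 + 8 * t ^+ 4).
Proof.
move=> bE.
have e1 : dis 0 (kap R * t) = - t + 6 * t ^+ 2 + 8 * t ^+ 3.
  rewrite (kappa_t1 (xq11 R) (xq12 R) (xq13 R) (xq22 R) (xq23 R) (xq33 R) fps16 (kapE R) (tmodE R)).
  rewrite -[RHS](dis_nf _ (2 * t + 4 * t ^+ 2) (1 + 2 * t + 8 * t ^+ 2) (- 2 * t - 4 * t ^+ 2)).
  by rewrite !dilE.
have e2 : dis 0 (kap R * t * t) = t - 6 * t ^+ 2 + 8 * t ^+ 3.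
  rewrite (kappa_t2 (xq11 R) (xq12 R) (xq13 R) (xq22 R) (xq23 R) (xq33 R) fps16 (kapE R) (tmodE R)).
  rewrite -[RHS](dis_nf _ (1 - 2 * t + 8 * t ^+ 2) (- 6 * t + 4 * t ^+ 2) (- 2 * t + 4 * t ^+ 2)).
  by rewrite !dilE.
have e3 : dis 0 (kap R * t * (t * t)) = t + 4 * t ^+ 2 - 4 * t ^+ 3 + 8 * t ^+ 4.
  rewrite (kappa_t3 (xq11 R) (xq12 R) (xq13 R) (xq22 R) (xq23 R) (xq33 R) fps16 (kapE R) (tmodE R)).
  rewrite -[RHS](dis_nf _ (4 * t + 4 * t ^+ 2 + 8 * t ^+ 3) (- 2 * t + 4 * t ^+ 2 + 8 * t ^+ 3)
    (2 * t + 8 * t ^+ 2 + 8 * t ^+ 3)).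
  by rewrite !dilE.
(* Multiplying by [kap] exchanges G for q G(q^4), which passes through [dis]. *)
have key : q ^+ 2 * b * dil 4 G = x%:R * (kap R * t) + y%:R * (kap R * t * t)
    + z%:R * (kap R * t * (t * t)).
  transitivity (kap R * (q * b * G)); last by rewrite bE; ring.
  transitivity (q * b * (kap R * G)); last by ring.
  by rewrite kap_oct; ring.
have := congr1 (dis 0) key; rewrite dis_dilM // !disD !dis_nat e1 e2 e3 => <-.
(* Residue 0 of q^2 b is residue 2 of b, shifted by one: 4(m + 1) - 2 = 4m + 2. *)
congr (_ * _); apply/fpsP => n; rewrite /dis fps_coefqXM fps_coefqM.
by case: n => // n; rewrite mulnS; congr b; lia.
Qed.

Lemma dis_first (b : fps R) : b * (dil 8 (pent R) - q * dil 4 G) = 1 ->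
  q * dis 3 b * G = 1%:R * t + 4%:R * t ^+ 2 + 4%:R * t ^+ 3.
Proof.
have -> : dil 8 (pent R) = dil 4 A by rewrite dilE.
move=> bT; set D := A ^+ 4 - q * G ^+ 4.
have bD : dis 3 b * D = G ^+ 3.
  rewrite -dis_dilM //.
  (* D(q^4) is a difference of fourth powers divisible by the denominator A(q^4) - q G(q^4) of b;
     the cofactor displays the four residues. *)
  have -> : b * dil 4 D = q ^+ 0 * dil 4 (A ^+ 3) + q ^+ 1 * dil 4 (A ^+ 2 * G)
      + q ^+ 2 * dil 4 (A * G ^+ 2) + q ^+ 3 * dil 4 (G ^+ 3).
    rewrite /D fps_dilD // fps_dilN // !(fps_dilX, fps_dilM) // fps_dilq //.
    transitivity (b * (dil 4 A - q * dil 4 G) * (dil 4 A ^+ 3 + q * dil 4 A ^+ 2 * dil 4 G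
      + q ^+ 2 * dil 4 A * dil 4 G ^+ 2 + q ^+ 3 * dil 4 G ^+ 3)); first by ring.
    by rewrite bT; ring.
  by rewrite !disD !dis_qX //= !add0r.
(* Writing A = z G gives D = G^4 (z^4 - q), and [hquo_zquo3] eliminates z. Modulo 16, 1/(1 - 4t^2) =
   1 + 4t^2, and t(1 + 4t)(1 + 4t^2) is t + 4t^2 + 4t^3. *)
have tD : t * (1 + 4 * t) * D = q * G ^+ 4 * (1 - 4 * t ^+ 2).
  rewrite /D -zquo_oct.
  transitivity (G ^+ 4 * (t * zquo R * zquo R ^+ 3 * (1 + 4 * t) - q * t * (1
      + 4 * t))); first by ring.
  rewrite tmod_zquo; transitivity (G ^+ 4 * q * (hquo R * zquo R ^+ 3 * (1 + 4 * t) - t * (1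
      + 4 * t))).
    by ring.
  by rewrite hquo_zquo3; ring.
have D0 : D 0%N = 1 by rewrite /D fps_coefD fps_coefN fps_coef0M mul0r oppr0 addr0 !coef0E.
apply: (fps_mulI D0).
transitivity (q * G * (dis 3 b * D)); first by ring.
rewrite bD; transitivity (q * G ^+ 4 * (1 - 4 * t ^+ 2) * (1 + 4 * t ^+ 2)).
  by apply: (mod16 fps16 (q * G ^+ 4 * t ^+ 4)); ring.
by rewrite -tD; apply: (mod16 fps16 (D * t ^+ 4)); ring.
Qed.

Lemma dis_period (b : fps R) : b * (dil 8 (pent R) - q * dil 4 G) = 1 ->
  dis 2 (dis 2 (dis 2 (dis 3 b))) = dis 2 (dis 2 (dis 3 b)).
Proof.
move=> /dis_first/dis_step b2.
have {b2} /dis_step b3 : q * dis 2 (dis 3 b) * G = 7%:R * t + 14%:R * t ^+ 2 + 8%:R * t ^+ 3.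
  by rewrite b2; apply: (mod16 fps16 (- t ^+ 2 + t ^+ 3 + 2 * t ^+ 4)); ring.
have {b3} b3 : q * dis 2 (dis 2 (dis 3 b)) * G = 15%:R * t + 6%:R * t ^+ 2 + 8%:R * t ^+ 3.
  by rewrite b3; apply: (mod16 fps16 (- t ^+ 2 + 8 * t ^+ 3 + 4 * t ^+ 4)); ring.
(* The numerator is now fixed by [dis_step], so it suffices to cancel q G. *)
apply: (@fps_mulI _ G) => //; apply: fps_qI.
transitivity (q * dis 2 (dis 2 (dis 2 (dis 3 b))) * G); first by ring.
rewrite (dis_step b3); transitivity (q * dis 2 (dis 2 (dis 3 b)) * G); last by ring.
by rewrite b3; apply: (mod16 fps16 (- t + 5 * t ^+ 2 + 8 * t ^+ 3 + 4 * t ^+ 4)); ring.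
Qed.

End Dissection.

(** * Reduction of the integer coefficients modulo 16 *)

Definition fps_map (R : comUnitRingType) (f : fps int) : fps R := fun n => (f n)%:~R.

Lemma fps_mapM (R : comUnitRingType) (f g : fps int) :
  fps_map R (f * g) = fps_map R f * fps_map R g.
Proof.
apply/fpsP => n; rewrite /fps_map !fps_coefM rmorph_sum /=.
by apply: eq_bigr => i _; rewrite rmorphM.
Qed.

Lemma schurS_fps (R : comUnitRingType) :
  fps_map R schurS * (fps_dil 8 (pent R) - fps_q R * fps_dil 4 (oct R)) = 1.
Proof.
have thetaE e : fps_map R (theta int e) = theta R e.
  by apply/fpsP => n; rewrite /fps_map /theta rmorph_nat.
have dilE k f : fps_map R (fps_dil k f) = fps_dil k (fps_map R f).
  by apply/fpsP => n; rewrite /fps_map /fps_dil; case: ifP.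
have <- : fps_map R (fps_dil 8 (pent int) - fps_q int * fps_dil 4 (oct int))
    = fps_dil 8 (pent R) - fps_q R * fps_dil 4 (oct R).
  rewrite -[pent R]thetaE -[oct R]thetaE -!dilE -[fps_q R](_ : fps_map R (fps_q int) = _).
    by rewrite -fps_mapM; apply/fpsP => n; rewrite /fps_map fps_coefD fps_coefN rmorphB.
  by apply/fpsP => n; rewrite /fps_map /fps_q; case: eqP.
rewrite -jacobi_product -fps_mapM mulrC.
have -> : qpoch int 1 6 * qpoch int 5 6 * qpoch int 6 6 * schurS = 1 by apply/fpsP/schurS_gf.
by apply/fpsP => n; rewrite /fps_map !fps_coef1; case: eqP.
Qed.

Lemma eq_intr_mod16 (x y : int) :
  x%:~R = y%:~R :> 'Z_16 -> (x = y %[mod 16])%Z.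
Proof.
move=> xy; apply/eqP; rewrite eqz_mod_dvd.
have : (x - y)%:~R = 0 :> 'Z_16 by rewrite rmorphB /= xy subrr.
have zeroP n : n%:R = 0 :> 'Z_16 -> (16 %| n)%N.
  by move=> /(congr1 (@nat_of_ord _)); rewrite val_Zp_nat // => /eqP.
case: (x - y) => n; first by move/zeroP.
by rewrite NegzE mulrNz => /eqP; rewrite oppr_eq0 => /eqP/zeroP; rewrite dvdzE abszN.
Qed.

Theorem theorem4p2 (n : nat) :
  (schurS (256 * n + 171)%N = schurS (64 * n + 43)%N %[mod 16])%Z.
Proof.
apply: eq_intr_mod16.
have R16 : 16%:R = 0 :> 'Z_16 by apply/val_inj.
have := congr1 (fun f : fps 'Z_16 => f n) (dis_period R16 (schurS_fps _)).
rewrite /dis /fps_map.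
rewrite (_ : 4 * (4 * (4 * (4 * n + 2) + 2) + 2) + 3 = 256 * n + 171)%N; last by lia.
by rewrite (_ : 4 * (4 * (4 * n + 2) + 2) + 3 = 64 * n + 43)%N; last by lia.
Qed.
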